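(* Every Kochen-Specker vector system contains at least $18$ vectors.
   Context: Let $\mathbb{H}^2=\{(x,y,z)\in\mathbb{R}^3 : x^2+y^2+z^2=1,\ z>0\}$. A vector system is a finite subset $\mathcal{K}\subseteq\mathbb{H}^2$. It is 101-colourable if one can assign $0$ or $1$ to each vector of $\mathcal{K}$ such that (i) no two orthogonal vectors are both assigned $0$, and (ii) no three mutually orthogonal vectors are all assigned $1$. A Kochen-Specker vector system is a vector system that is not 101-colourable; its size is its number of vectors. *)

(* Defs.v *)
From Stdlib Require Import Reals List.
Open Scope R_scope.

Definition vec3 : Type := (R * R * R)%type.

Definition dot (u v : vec3) : R :=
  let '(x1, y1, z1) := u in let '(x2, y2, z2) := v in
  x1 * x2 + y1 * y2 + z1 * z2.

Definition orthogonal (u v : vec3) : Prop := dot u v = 0.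

Definition in_H2 (v : vec3) : Prop :=
  let '(x, y, z) := v in x * x + y * y + z * z = 1 /\ 0 < z.

Definition vector_system (K : list vec3) : Prop :=
  NoDup K /\ (forall v, In v K -> in_H2 v).

(* 101-colouring: c v = false means colour 0, c v = true means colour 1. *)
Definition colourable_101 (K : list vec3) : Prop :=
  exists c : vec3 -> bool,
    (forall u v, In u K -> In v K -> orthogonal u v ->
       ~ (c u = false /\ c v = false)) /\
    (forall u v w, In u K -> In v K -> In w K ->
       orthogonal u v -> orthogonal v w -> orthogonal u w ->
       ~ (c u = true /\ c v = true /\ c w = true)).

Definition KS_system (K : list vec3) : Prop :=
  vector_system K /\ ~ colourable_101 K.

(* Main.v *)
Require Import Defs.
From Stdlib Require Import Reals List Lra Lia Arith Bool Classical.
Import ListNotations.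

(** The orthogonality graph of a vector system has no 4-cycle, since two distinct lines have only one
    common normal. In a minimal uncolourable graph every vertex lies in a triangle and has degree at
    least 3. Triangles are then edge-disjoint, and a short case distinction shows that every triangle
    shares a vertex with another one: otherwise the neighbours of one of its vertices could be
    forced to colour 1 in the graph on the remaining 14 vertices.

    What remains is a finite search. All systems of triangles on at most 17 vertices are enumerated by
    growing a labelled partial system; labels are handed out so that a vertex in many triangles comes
    before one in few, which removes most symmetric copies. For a complete system, a set of
    vertices meeting every triangle exactly once must contain an edge outside the triangles, and one
    branches over these edges. The search fails only for systems that contain a 10-vertex graph with no realization
    by vectors of R^3. *)

Open Scope nat_scope.

(** * The search *)

(** Only triangles are enumerated outright: any other edge enters late, when a proposed colouring
    can fail only through it. A colouring is handled as its set of vertices coloured 0, an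
    independent set meeting every triangle. The exploration answers [true] for a refuted branch and
    [false] when fuel runs out, so soundness amounts to following one hypothetical uncolourable
    graph down the tree; neither termination nor completeness has to be proved.

    For a triangle meeting no other one, some corner [x] can take 0 and the other two corners 1 once
    all outside neighbours of [x] have colour 1. Three outside neighbours at every corner would need
    more than 14 vertices, so some corner has at most two, and the two forced runs treat one and
    two. The outside neighbours of all corners are distinct and pairwise non-adjacent, and each lies
    in a triangle, hence in a triangle of its own. Choosing a corner with fewest neighbours
    therefore gives at least 3 or 6 triangles, the lower bounds in these runs. *)

Inductive bset := B0 | BF (b : bset) | BT (b : bset).
Fixpoint mem (b : bset) (n : nat) : bool :=
  match b, n with
  | B0, _ => false
  | BF _, 0 => false
  | BT _, 0 => true
  | BF b, S n => mem b n
  | BT b, S n => mem b n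
  end.
Fixpoint union (a b : bset) : bset :=
  match a, b with
  | B0, _ => b
  | _, B0 => a
  | BF a, BF b => BF (union a b)
  | BF a, BT b | BT a, BF b | BT a, BT b => BT (union a b)
  end.
Fixpoint diff (a b : bset) : bset :=
  match a, b with
  | B0, _ => B0
  | _, B0 => a
  | BF a, BF b | BF a, BT b | BT a, BT b => BF (diff a b)
  | BT a, BF b => BT (diff a b)
  end.
Fixpoint bit (n : nat) : bset := match n with 0 => BT B0 | S n => BF (bit n) end.
Fixpoint full (n : nat) : bset := match n with 0 => B0 | S n => BT (full n) end.
Fixpoint is_empty (b : bset) : bool := match b with B0 => true | BF b => is_empty b | BT _ => false end.

(* The neighbours of a label, kept both as a set (for membership) and as a list (for iteration). *)
Definition row := (bset * list nat)%type.
Definition no_nbrs : row := (B0, []).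
Definition nbrs (rows : list row) (i : nat) : row := nth i rows no_nbrs.
Fixpoint upd {T} (i : nat) (f : T -> T) (l : list T) : list T :=
  match l, i with
  | [], _ => []
  | h :: t, 0 => f h :: t
  | h :: t, S i => h :: upd i f t
  end.
Definition add_nbr (i j : nat) (rows : list row) := upd i (fun r => (union (bit j) (fst r), j :: snd r)) rows.
Definition addedge (i j : nat) (rows : list row) := add_nbr i j (add_nbr j i rows).
Definition ball (ms : list bset) (l : list nat) : bset := fold_left (fun m a => union m (nth a ms B0)) l B0.
(** Walks may retrace their steps, so the known neighbours of [x] are included. Every other member
    is barred from being a neighbour by the absence of 4-cycles; one set thus removes both the
    settled and the impossible pairs. *)
Definition ball3 (rows : list row) (x : nat) : bset :=
  fold_left (fun m a => fold_left (fun m b => union m (fst (nbrs rows b))) (snd (nbrs rows a)) m) (snd (nbrs rows x)) B0.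
Definition balls3 (rows : list row) : list bset :=
  let m1 := map fst rows in
  let m2 := map (fun r => ball m1 (snd r)) rows in
  map (fun r => ball m2 (snd r)) rows.

Definition tri := (nat * nat * nat)%type.
(* [sk] labels are in use. The vertex of label [b] lies in at most as many triangles as the vertex of
   label [nth b scaps 0]; a label that is its own cap is unconstrained. [sroot] is the first label of the
   current connected component. *)
Record st := St { sk : nat; srows : list row; stris : list tri; scaps : list nat; sroot : option nat }.
Definition addtri (s : st) (a b c : nat) : st :=
  St (sk s) (addedge a b (addedge a c (addedge b c (srows s)))) ((a, b, c) :: stris s) (scaps s) (sroot s).
Definition addlab (s : st) (c : option nat) : st :=
  St (S (sk s)) (srows s ++ [no_nbrs]) (stris s) (scaps s ++ [match c with Some c => c | None => sk s end]) (sroot s).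
Definition setroot (s : st) (r : nat) : st := St (sk s) (srows s) (stris s) (scaps s) (Some r).

Definition nnbrs (s : st) (i : nat) := length (snd (nbrs (srows s) i)).
(** Climbs the caps to the first closed label, one below [x]: there the number of listed neighbours
    is the exact triangle degree, so a comparison is conclusive. Open labels on the way have only
    lower bounds. Running out of fuel merely forgoes pruning. *)
Fixpoint below_cap (s : st) (x n b fuel : nat) : bool :=
  match fuel with
  | 0 => true
  | S fuel => let c := nth b (scaps s) 0 in
    if c =? b then true else if c <? x then n <=? nnbrs s c else below_cap s x n c fuel
  end.
Definition cap_ok (s : st) (x b : nat) : bool := below_cap s x (nnbrs s b) b 20.

(* The colourings found by [find0] and [findj] are checked by [goodcol], so nothing is proved about them.
   [find0] looks for a set of labels meeting all triangles with no two of them possibly adjacent, [findj]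
   for one with at most [j] possibly adjacent pairs. *)
Fixpoint find0 (bl : list bset) (ts : list tri) (cur : list nat) (cm blk : bset) : option (list nat) :=
  match ts with
  | [] => Some cur
  | (a, b, c) :: tl =>
    if mem cm a then find0 bl tl cur cm blk else
    if mem cm b then find0 bl tl cur cm blk else
    if mem cm c then find0 bl tl cur cm blk else
    let try v := if mem blk v then None else find0 bl tl (v :: cur) (union (bit v) cm) (union blk (nth v bl B0)) in
    match try a with Some r => Some r | None =>
    match try b with Some r => Some r | None => try c end end
  end.
Fixpoint findj (unk : list bset) (rows : list row) (j : nat) (ts : list tri) (cur : list nat) (cm blk : bset) : option (list nat) :=
  match ts with
  | [] => Some cur
  | (a, b, c) :: tl =>
    if mem cm a then findj unk rows j tl cur cm blk else
    if mem cm b then findj unk rows j tl cur cm blk else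
    if mem cm c then findj unk rows j tl cur cm blk else
    let try v := if mem blk v then None else
      let u := nth v unk B0 in
      let cost := length (filter (mem u) cur) in
      if cost <=? j then
      findj unk rows (j - cost) tl (v :: cur) (union (bit v) cm) (union blk (fst (nbrs rows v)))
      else None in
    match try a with Some r => Some r | None =>
    match try b with Some r => Some r | None => try c end end
  end.
Fixpoint deepen (unk : list bset) (rows : list row) (ts : list tri) (blk : bset) (j fuel : nat) : option (list nat) :=
  match fuel with 0 => None | S fuel =>
    match findj unk rows j ts [] B0 blk with Some r => Some r | None => deepen unk rows ts blk (S j) fuel end end.
Definition findcol (unk : list bset) (rows : list row) ts s :=
  match find0 (map (fun p => union (fst p) (fst (snd p))) (combine unk rows)) ts [] B0 (full s) with
  | Some r => Some r
  | None => deepen unk rows ts (full s) 1 12 end.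

(* The unembeddable graph: entry [i] lists the earlier vertices adjacent to vertex [i]. *)
Definition pat : list (list nat) := [ []; [0]; [0]; [0;2]; [1]; [1;4]; [2]; [2;6;5]; [4;3]; [4;8;6] ].
Fixpoint match_pat (rows : list row) (all : list nat) (ps : list (list nat)) (im : list nat) : option (list nat) :=
  match ps with
  | [] => Some im
  | p :: tl =>
    let cand := match p with [] => all | j :: _ => snd (nbrs rows (nth j im 0)) end in
    let fix go l := match l with [] => None | v :: l =>
      if existsb (Nat.eqb v) im then go l else
      if forallb (fun j => mem (fst (nbrs rows (nth j im 0))) v) p then
        match match_pat rows all tl (im ++ [v]) with Some r => Some r | None => go l end
      else go l end in go cand
  end.
(** Rechecks the 16 edges of an image, so nothing is proved about [match_pat]. The two inequalities
    exclude exactly the degenerate coincidences that the geometry allows. *)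
Definition checkX (rows : list row) (im : list nat) : bool :=
  let e i j := mem (fst (nbrs rows (nth i im 0))) (nth j im 0) in
  e 0 1 && e 0 2 && e 0 3 && e 2 3 && e 1 4 && e 1 5 && e 4 5 && e 2 6 && e 2 7 && e 6 7
  && e 4 8 && e 4 9 && e 8 9 && e 3 8 && e 5 7 && e 6 9
  && negb (nth 3 im 0 =? nth 1 im 0) && negb (nth 5 im 0 =? nth 0 im 0).
Definition hasX (k : nat) (rows : list row) : bool :=
  match match_pat rows (seq 0 k) pat [] with Some im => checkX rows im | None => false end.

Definition pairs (unk : list bset) (c : list nat) : list (nat * nat) :=
  flat_map (fun x => let u := nth x unk B0 in map (fun y => (x, y)) (filter (fun y => (x <? y) && mem u y) c)) c.
(** Here [c] is a candidate for the set of colour 0. Only known edges inside it are excluded; the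
    undecided ones are left to [pairs]. *)
Definition goodcol (k s : nat) (rows : list row) (ts : list tri) (c : list nat) : bool :=
  forallb (fun i => (i <? k) && (s <=? i)) c
  && forallb (fun t => match t with (x, y, z) => existsb (Nat.eqb x) c || existsb (Nat.eqb y) c || existsb (Nat.eqb z) c end) ts
  && forallb (fun x => let m := fst (nbrs rows x) in forallb (fun y => negb (mem m y)) c) c.

Definition addno (x y : nat) (no : list bset) := upd x (union (bit y)) (upd y (union (bit x)) no).
Definition unknown (k : nat) (rows : list row) (no : list bset) : list bset :=
  let fk := full k in
  map (fun p => diff fk (union (fst p) (snd p))) (combine (balls3 rows) no).

(** Case split on the first pair that is an edge: in later branches the pairs already treated count
    as non-edges. *)
Fixpoint add_edges_among (rec : list row -> list bset -> bool) (rows : list row) (ps : list (nat * nat)) (no : list bset) : bool :=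
  match ps with
  | [] => true
  | (x, y) :: ps => if rec (addedge x y rows) no then add_edges_among rec rows ps (addno x y no) else false
  end.

(* [s]: the labels below [s] must get colour 1. [tmin]: lower bound on the number of triangles.
   [main]: degrees are at least 3 and no triangle is isolated. *)
Section Search.
Variables (main : bool) (nmax s tmin : nat).

Fixpoint add_edges (fuel : nat) (k : nat) (ts : list tri) (first : bool) (rows : list row) (no : list bset) : bool :=
  match fuel with 0 => false | S fuel =>
    let unk := unknown k rows no in
    (* Two known neighbours and no pair left undecided: the label would have degree 2. *)
    if (if main then
          existsb (fun p => match snd (snd p) with [_; _] => is_empty (fst p) | _ => false end) (combine unk rows)
        else false) then true else
    match findcol unk rows ts s with
    | None => false
    | Some c =>
      if goodcol k s rows ts c then
      match pairs unk c with
      | [] => true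
      | ps =>
        (* The bound 11 only saves time: no smaller system turns out to need this test. *)
        if (if first then if 11 <=? length ts then hasX k rows else false else false) then true else
        add_edges_among (add_edges fuel k ts false) rows ps no
      end else false
    end
  end.

Definition isolated (z : st) (t : tri) : bool :=
  match t with (a, b, c) => (nnbrs z a =? 2) && (nnbrs z b =? 2) && (nnbrs z c =? 2) end.
Definition leaf (z : st) : bool :=
  if length (stris z) <? tmin then true else
  if (if main then existsb (isolated z) (stris z) else false) then true else
  add_edges 30 (sk z) (rev (stris z)) true (srows z) (map (fun _ => B0) (srows z)).

(** The two forced vertices are neighbours of the same removed corner. An edge between them would
    give that corner a second triangle, and a common neighbour would close a 4-cycle. *)
Definition sepbad (z : st) : bool :=
  mem (fst (nbrs (srows z) 0)) 1 || existsb (mem (fst (nbrs (srows z) 1))) (snd (nbrs (srows z) 0)).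

(* [Next x]: all labels below [x] are closed, i.e. all their triangles are known.
   [Dec x y _]: decide whether [x] and [y] lie in a common triangle.
   [Fresh x c]: add triangles at [x] with two new labels, the larger one capped by [c]. *)
Inductive mode := Next (x : nat) | Dec (x y : nat) (b3 : bset) | Fresh (x : nat) (c : option nat).

(** Every test that cuts a branch is a necessary condition on the graph sought. Conditionals replace
    boolean connectives because evaluation by the virtual machine is eager in arguments. *)
Fixpoint explore (fuel : nat) (z : st) (m : mode) : bool :=
  match fuel with 0 => false | S fuel =>
  let step z x y w :=
    let z' := addtri z x y w in
    if cap_ok z' x x then if cap_ok z' x y then if cap_ok z' x w then
      explore fuel z' (Dec x (S y) (ball3 (srows z') x)) else true else true else true in
  match m with
  | Next x =>
    if x <? sk z then explore fuel z (Dec x (S x) (ball3 (srows z) x)) else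
    if (match sk z with 0 => true | _ => leaf z end) then
      (* All labels are closed, so a further vertex starts a new component. It is chosen with
         greatest triangle degree among the unlabelled vertices and bounds all later ones. *)
      if sk z <? nmax then explore fuel (setroot (addlab z (sroot z)) (sk z)) (Fresh (sk z) (Some (sk z))) else true
    else false
  | Dec x y b3 =>
    if y <? sk z then
      if mem b3 y then explore fuel z (Dec x (S y) b3) else
      if explore fuel z (Dec x (S y) b3) then
        (* A third label below [y] needs no attempt: below [x] it is closed, between [x] and [y] it
           is decided, so the triangle would already be known. *)
        if (let m := union b3 (ball3 (srows z) y) in
            forallb (fun w => if mem m w then true else step z x y w) (seq (S y) (sk z - S y))) then
          if sk z <? nmax then step (addlab z (sroot z)) x y (sk z) else true
        else false
      else false
    else explore fuel z (Fresh x (sroot z))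
  | Fresh x c =>
    if
      match nnbrs z x with 0 => true | _ =>
      if cap_ok z x x then
        if (if s =? 2 then if x <? 2 then sepbad z else false else false) then true
        else explore fuel z (Next (S x))
      else true end
    then
      if S (sk z) <? nmax then
        let z' := addtri (addlab (addlab z c) (Some (sk z))) x (sk z) (S (sk z)) in
        (* The larger vertex of this pair caps the next pair, so pairs of new vertices at [x] come
           in decreasing order of their larger members. *)
        if cap_ok z' x x then explore fuel z' (Fresh x (Some (sk z))) else true
      else true
    else false
  end end.

(** All forced labels are capped by label 0, so the forced vertex of largest triangle degree must be
    numbered first. *)
Definition init : st := St s (map (fun _ => no_nbrs) (seq 0 s)) [] (map (fun _ => 0) (seq 0 s)) None.
Definition run : bool := explore 400 init (Next 0).
End Search.

Lemma run_forced1 : run false 14 1 3 = true.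
Proof. vm_cast_no_check (eq_refl true). Qed.
Lemma run_forced2 : run false 14 2 6 = true.
Proof. vm_cast_no_check (eq_refl true). Qed.
Lemma run_main : run true 17 0 0 = true.
Proof. vm_cast_no_check (eq_refl true). Qed.

(** * Soundness of the search *)

Lemma mem_union a b n : mem (union a b) n = mem a n || mem b n.
Proof.
  revert b n; induction a; intros [|b|b] [|n]; simpl; rewrite ?orb_false_r, ?orb_true_r; auto.
Qed.
Lemma mem_bit i j : mem (bit i) j = (i =? j).
Proof. revert j; induction i; intros [|j]; simpl; auto. Qed.
Lemma mem_full n j : mem (full n) j = (j <? n).
Proof.
  revert j; induction n; intros [|j]; auto. simpl mem. rewrite IHn. reflexivity.
Qed.
Lemma mem_diff a b n : mem (diff a b) n = mem a n && negb (mem b n).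
Proof.
  revert b n; induction a; intros [|b|b] [|n]; simpl; rewrite ?andb_true_r, ?andb_false_r; auto.
Qed.
Lemma is_empty_mem b n : is_empty b = true -> mem b n = false.
Proof. revert n; induction b; intros [|n]; simpl; auto; discriminate. Qed.

Lemma mem_fold {T} (h : bset -> T -> bset) (p : T -> bool) y :
  (forall m a, mem (h m a) y = mem m y || p a) ->
  forall l m, mem (fold_left h l m) y = mem m y || existsb p l.
Proof.
  intros H l; induction l; intros m; simpl; rewrite ?orb_false_r; auto.
  rewrite IHl, H, orb_assoc; auto.
Qed.

Lemma existsb_ext_eq {T} (p q : T -> bool) l : (forall a, p a = q a) -> existsb p l = existsb q l.
Proof. intros H; induction l; simpl; auto. rewrite H, IHl; auto. Qed.
Lemma upd_length {T} i (f : T -> T) l : length (upd i f l) = length l.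
Proof. revert i; induction l; intros [|i]; simpl; auto. Qed.
Lemma nth_upd {T} i (f : T -> T) l d j :
  nth j (upd i f l) d = if (j =? i) && (i <? length l) then f (nth i l d) else nth j l d.
Proof.
  revert i j; induction l as [|x l IH]; intros [|i] [|j]; simpl; rewrite ?andb_false_r; auto.
Qed.
Lemma nth_map_lt {T U} (f : T -> U) l i d d' : i < length l -> nth i (map f l) d' = f (nth i l d).
Proof.
  intros H. rewrite (nth_indep _ d' (f d)); [apply map_nth | rewrite length_map; auto].
Qed.

Lemma nbrs_add_nbr i j rows m : i < length rows ->
  nbrs (add_nbr i j rows) m = if m =? i then (union (bit j) (fst (nbrs rows i)), j :: snd (nbrs rows i)) else nbrs rows m.
Proof.
  intros H. unfold nbrs, add_nbr. rewrite nth_upd.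
  apply Nat.ltb_lt in H; rewrite H, andb_true_r. reflexivity.
Qed.
Lemma addedge_length i j rows : length (addedge i j rows) = length rows.
Proof. unfold addedge, add_nbr. rewrite !upd_length; auto. Qed.

(** Stated for a relation, so that no triangle has to be selected for each vertex. *)
Lemma pigeon {T U} (R : T -> U -> Prop) (W : list T) : NoDup W ->
  forall ts : list U,
  (forall w, In w W -> exists t, In t ts /\ R w t) ->
  (forall w w' t, In w W -> In w' W -> R w t -> R w' t -> w = w') ->
  length W <= length ts.
Proof.
  induction 1 as [|w W Hw HW IH]; intros ts H1 H2; simpl; [lia|].
  destruct (H1 w) as [t [Ht Hwt]]; [left; auto|].
  apply in_split in Ht; destruct Ht as [l1 [l2 ->]].
  rewrite length_app; simpl.
  assert (length W <= length (l1 ++ l2)); [|rewrite length_app in *; lia].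
  apply IH.
  - intros w' Hw'. destruct (H1 w') as [t' [Ht' Hwt']]; [right; auto|].
    exists t'; split; auto.
    apply in_app_iff in Ht'. apply in_app_iff.
    destruct Ht' as [?|[->|?]]; auto.
    exfalso; apply Hw. rewrite (H2 w w' t'); auto; [left | right]; auto.
  - intros a b t' Ha Hb; apply H2; right; auto.
Qed.

(** * Graphs without 4-cycles and their colourings *)

Section Graph.
Variables (A : Type) (eqA : forall x y : A, {x = y} + {x <> y}) (E : A -> A -> bool).
Hypothesis E_sym : forall u v, E u v = E v u.
Hypothesis E_irr : forall u, E u u = false.
Hypothesis E_C4 : forall a b c d,
  E a b = true -> E b c = true -> E c d = true -> E d a = true -> a = c \/ b = d.
Hypothesis E_X : forall v0 v1 v2 v3 v4 v5 v6 v7 v8 v9,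
  E v0 v1 = true -> E v0 v2 = true -> E v0 v3 = true -> E v2 v3 = true ->
  E v1 v4 = true -> E v1 v5 = true -> E v4 v5 = true ->
  E v2 v6 = true -> E v2 v7 = true -> E v6 v7 = true ->
  E v4 v8 = true -> E v4 v9 = true -> E v8 v9 = true ->
  E v3 v8 = true -> E v5 v7 = true -> E v6 v9 = true -> v3 = v1 \/ v5 = v0.

Definition Tri u v w := E u v = true /\ E u w = true /\ E v w = true.
Definition colouring (V : list A) (c : A -> bool) : Prop :=
  (forall u v, In u V -> In v V -> E u v = true -> c u = true \/ c v = true) /\
  (forall u v w, In u V -> In v V -> In w V -> Tri u v w ->
     c u = false \/ c v = false \/ c w = false).

Lemma E_neq u v : E u v = true -> u <> v.
Proof. intros H ->. rewrite E_irr in H; discriminate. Qed.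
Lemma E_comm u v : E u v = true -> E v u = true.
Proof. rewrite E_sym; auto. Qed.
Lemma Tri_213 u v w : Tri u v w -> Tri v u w.
Proof. intros (?&?&?); repeat split; auto using E_comm. Qed.
Lemma Tri_132 u v w : Tri u v w -> Tri u w v.
Proof. intros (?&?&?); repeat split; auto using E_comm. Qed.
(** Two different third vertices would form a 4-cycle with [u] and [v]. Hence triangles are
    edge-disjoint. *)
Lemma Tri_unique u v w w' : Tri u v w -> Tri u v w' -> w = w'.
Proof.
  intros (H1&H2&H3) (_&H2'&H3').
  destruct (E_C4 w u w' v); auto using E_comm.
  apply E_neq in H1; contradiction.
Qed.

Section Soundness.
Variables (V : list A) (main : bool) (nmax s tmin : nat) (f0 : nat -> A).
Hypothesis HV : NoDup V.
Hypothesis Hn : length V <= nmax.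
(** With [s = 0] there is no such index, so [V] has no colouring; otherwise no colouring gives 1 to
    all forced vertices. *)
Hypothesis Hcol : forall c, colouring V c -> exists i, i < s /\ c (f0 i) = false.

Record rows_ok (k : nat) (f : nat -> A) (rows : list row) : Prop := {
  ro_len : length rows = k;
  ro_mem : forall i j, mem (fst (nbrs rows i)) j = true <-> In j (snd (nbrs rows i));
  ro_E : forall i j, In j (snd (nbrs rows i)) -> i < k /\ j < k /\ E (f i) (f j) = true;
  ro_sym : forall i j, In j (snd (nbrs rows i)) -> In i (snd (nbrs rows j)) }.

Lemma addedge_in k rows i j m l : length rows = k -> i < k -> j < k -> i <> j ->
  In l (snd (nbrs (addedge i j rows) m)) <->
  (m = i /\ l = j) \/ (m = j /\ l = i) \/ In l (snd (nbrs rows m)).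
Proof.
  intros Hl Hi Hj Hij. unfold addedge.
  rewrite nbrs_add_nbr by (unfold add_nbr; rewrite upd_length; lia).
  rewrite !nbrs_add_nbr by lia.
  destruct (Nat.eqb_spec m i); destruct (Nat.eqb_spec m j); destruct (Nat.eqb_spec i j); subst; simpl; try lia;
  intuition (subst; auto; lia).
Qed.

Lemma rows_ok_addedge k f rows i j : rows_ok k f rows -> i < k -> j < k ->
  E (f i) (f j) = true -> rows_ok k f (addedge i j rows).
Proof.
  intros [H1 H2 H3 H4] Hi Hj He.
  assert (Hij : i <> j) by (intros ->; rewrite E_irr in He; discriminate).
  split.
  - rewrite addedge_length; auto.
  - intros m l. rewrite (addedge_in k) by auto. rewrite <- H2. unfold addedge.
    rewrite nbrs_add_nbr by (unfold add_nbr; rewrite upd_length; lia).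
    rewrite !nbrs_add_nbr by lia.
    destruct (Nat.eqb_spec m i); destruct (Nat.eqb_spec m j); destruct (Nat.eqb_spec i j); subst; simpl; try lia;
    rewrite ?mem_union, ?mem_bit, ?orb_true_iff, ?Nat.eqb_eq; intuition (subst; auto; lia).
  - intros m l. rewrite (addedge_in k) by auto.
    intros [[-> ->]|[[-> ->]|H]]; auto using E_comm.
  - intros m l. rewrite !(addedge_in k) by auto. intuition auto.
Qed.

Lemma rows_ok_ext k f f' rows : (forall i, i < k -> f i = f' i) -> rows_ok k f rows -> rows_ok k f' rows.
Proof.
  intros Hf [H1 H2 H3 H4]; split; auto.
  intros i j H. destruct (H3 i j H) as (?&?&?). rewrite <- !Hf by auto. auto.
Qed.

Lemma ball3_spec rows x y : mem (ball3 rows x) y =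
  existsb (fun a => existsb (fun b => mem (fst (nbrs rows b)) y) (snd (nbrs rows a))) (snd (nbrs rows x)).
Proof.
  unfold ball3.
  rewrite (mem_fold _ (fun a => existsb (fun b => mem (fst (nbrs rows b)) y) (snd (nbrs rows a)))); auto.
  intros m a. apply (mem_fold _ (fun b => mem (fst (nbrs rows b)) y)).
  intros; apply mem_union.
Qed.

Lemma balls3_length rows : length (balls3 rows) = length rows.
Proof. unfold balls3; rewrite length_map; auto. Qed.

Lemma ball_spec ms l y : mem (ball ms l) y = existsb (fun a => mem (nth a ms B0) y) l.
Proof. unfold ball. rewrite (mem_fold _ (fun a => mem (nth a ms B0) y)); auto. intros; apply mem_union. Qed.

Lemma balls3_spec rows x y : mem (nth x (balls3 rows) B0) y = mem (ball3 rows x) y.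
Proof.
  rewrite ball3_spec. unfold balls3. set (m1 := map fst rows).
  assert (Hm1 : forall b, nth b m1 B0 = fst (nbrs rows b)) by (intros; apply (map_nth fst rows no_nbrs)).
  set (m2 := map (fun r => ball m1 (snd r)) rows).
  assert (Hm2 : forall a, nth a m2 B0 = ball m1 (snd (nbrs rows a))).
  { intros a. apply (map_nth (fun r : row => ball m1 (snd r)) rows no_nbrs). }
  replace (nth x (map (fun r => ball m2 (snd r)) rows) B0) with (ball m2 (snd (nbrs rows x)))
    by (symmetry; apply (map_nth (fun r : row => ball m2 (snd r)) rows no_nbrs)).
  rewrite ball_spec. apply existsb_ext_eq; intros a.
  rewrite Hm2, ball_spec. apply existsb_ext_eq; intros b. rewrite Hm1; auto.
Qed.

(* An edge not yet known would close a 4-cycle with the walk of length 3. *)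
Lemma ball3_E k f rows x y :
  (forall i j, i < k -> j < k -> f i = f j -> i = j) -> rows_ok k f rows -> x < k -> y < k ->
  mem (ball3 rows x) y = true -> E (f x) (f y) = true -> In y (snd (nbrs rows x)).
Proof.
  intros Hinj [H1 H2 H3 H4] Hx Hy H He. rewrite ball3_spec in H.
  apply existsb_exists in H; destruct H as [a [Ha H]].
  apply existsb_exists in H; destruct H as [b [Hb H]]. apply H2 in H.
  destruct (H3 _ _ Ha) as (_&?&Ea), (H3 _ _ Hb) as (_&?&Eb), (H3 _ _ H) as (_&_&Ec).
  destruct (E_C4 _ _ _ _ Ea Eb Ec (E_comm _ _ He)) as [Hc|Hc]; apply Hinj in Hc; auto; subst; auto.
Qed.

Lemma ball3_list k f rows x y : rows_ok k f rows -> In y (snd (nbrs rows x)) -> mem (ball3 rows x) y = true.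
Proof.
  intros [H1 H2 H3 H4] H. rewrite ball3_spec.
  apply existsb_exists; exists y; split; auto.
  apply existsb_exists; exists x; split; auto. apply H2; auto.
Qed.

Lemma checkX_sound k f rows im :
  (forall i j, i < k -> j < k -> f i = f j -> i = j) -> rows_ok k f rows ->
  checkX rows im = true -> False.
Proof.
  intros Hinj [H1 H2 H3 H4] H. unfold checkX in H. cbv zeta in H.
  rewrite !andb_true_iff in H.
  assert (HE : forall i j, mem (fst (nbrs rows i)) j = true -> i < k /\ j < k /\ E (f i) (f j) = true).
  { intros i j Hij; apply H3, H2; auto. }
  decompose [and] H; clear H.
  repeat match goal with
  | h : mem _ _ = true |- _ => apply HE in h; destruct h as (?&?&?)
  | h : negb _ = true |- _ => apply negb_true_iff, Nat.eqb_neq in h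
  end.
  destruct (E_X (f (nth 0 im 0)) (f (nth 1 im 0)) (f (nth 2 im 0)) (f (nth 3 im 0)) (f (nth 4 im 0))
    (f (nth 5 im 0)) (f (nth 6 im 0)) (f (nth 7 im 0)) (f (nth 8 im 0)) (f (nth 9 im 0))) as [Hc|Hc];
  auto; apply Hinj in Hc; auto.
Qed.

Lemma hasX_sound k f rows :
  (forall i j, i < k -> j < k -> f i = f j -> i = j) -> rows_ok k f rows ->
  hasX k rows = true -> False.
Proof.
  unfold hasX. destruct (match_pat _ _ _ _); [|discriminate]. apply checkX_sound.
Qed.

(** * Complete triangle systems: branching over the remaining edges *)

Section Leaf.
Variables (k : nat) (f : nat -> A) (ts : list tri).
Hypothesis f_inj : forall i j, i < k -> j < k -> f i = f j -> i = j.
Hypothesis f_V : forall i, i < k -> In (f i) V.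
Hypothesis f_s : s <= k.
Hypothesis f_f0 : forall i, i < s -> f i = f0 i.
Hypothesis f_cover : forall v, In v V -> exists i, i < k /\ v = f i.
Hypothesis ts_all : forall u v w, In u V -> In v V -> In w V -> Tri u v w ->
  exists a b c, In (a, b, c) ts /\ a < k /\ b < k /\ c < k /\
   forall i, i = a \/ i = b \/ i = c -> f i = u \/ f i = v \/ f i = w.
Hypothesis Hdeg : main = true -> forall v a b, In v V -> exists u, In u V /\ E v u = true /\ u <> a /\ u <> b.

Definition no_ok (no : list bset) : Prop :=
  length no = k /\ forall i j, mem (nth i no B0) j = true -> E (f i) (f j) = false.

Lemma unknown_length rows no : length rows = k -> length no = k -> length (unknown k rows no) = k.
Proof. intros. unfold unknown. rewrite length_map, length_combine, balls3_length. lia. Qed.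

Lemma unknown_spec rows no i j : rows_ok k f rows -> no_ok no -> i < k -> j < k ->
  E (f i) (f j) = true -> ~ In j (snd (nbrs rows i)) -> mem (nth i (unknown k rows no) B0) j = true.
Proof.
  intros Hr [Hl Hno] Hi Hj He Hin. pose proof (ro_len _ _ _ Hr) as Hlr. unfold unknown.
  rewrite (nth_map_lt _ _ _ (B0, B0)) by (rewrite length_combine, balls3_length; lia).
  rewrite combine_nth by (rewrite balls3_length; lia). simpl.
  rewrite mem_diff, mem_full, mem_union, balls3_spec, andb_true_iff, negb_true_iff, orb_false_iff.
  split; [apply Nat.ltb_lt; auto|]. split.
  - destruct (mem (ball3 rows i) j) eqn:Hb; auto. exfalso; apply Hin.
    eapply ball3_E; eauto.
  - destruct (mem (nth i no B0) j) eqn:Hb; auto. apply Hno in Hb. congruence.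
Qed.

Lemma pairs_spec unk c x y : In (x, y) (pairs unk c) <->
  In x c /\ In y c /\ x < y /\ mem (nth x unk B0) y = true.
Proof.
  unfold pairs. rewrite in_flat_map. split.
  - intros [x' [Hx H]]. apply in_map_iff in H. destruct H as [y' [Heq H]]. injection Heq as -> ->.
    apply filter_In in H. rewrite andb_true_iff, Nat.ltb_lt in H. tauto.
  - intros (Hx&Hy&Hl&Ht). exists x; split; auto. apply in_map_iff. exists y; split; auto.
    apply filter_In. rewrite andb_true_iff, Nat.ltb_lt. auto.
Qed.

Lemma existsb_eqb x c : existsb (Nat.eqb x) c = true <-> In x c.
Proof.
  rewrite existsb_exists. split.
  - intros [y [Hy H]]. apply Nat.eqb_eq in H; subst; auto.
  - intros; exists x; split; auto. apply Nat.eqb_refl.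
Qed.

(** Giving 0 exactly to the vertices labelled in [c] is a legal colouring of [V] if no edge joins
    two of them, and it leaves every forced vertex at 1, against [Hcol]. *)
Lemma goodcol_sound rows no c : rows_ok k f rows -> no_ok no ->
  goodcol k s rows ts c = true ->
  (forall x y, In (x, y) (pairs (unknown k rows no) c) -> E (f x) (f y) = false) -> False.
Proof.
  intros Hr Hno Hg Hp. unfold goodcol in Hg. rewrite !andb_true_iff in Hg.
  destruct Hg as [[Hg1 Hg2] Hg3]. rewrite forallb_forall in Hg1, Hg2, Hg3.
  assert (Hk : forall i, In i c -> i < k /\ s <= i).
  { intros i Hi. specialize (Hg1 i Hi). rewrite andb_true_iff, Nat.ltb_lt, Nat.leb_le in Hg1. auto. }
  assert (HE : forall x y, In x c -> In y c -> E (f x) (f y) = false).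
  { assert (HE' : forall x y, In x c -> In y c -> x < y -> E (f x) (f y) = false).
    { intros x y Hx Hy Hl. destruct (E (f x) (f y)) eqn:He; auto.
      assert (Hnin : ~ In y (snd (nbrs rows x))).
      { intros Hin. apply (ro_mem _ _ _ Hr) in Hin. specialize (Hg3 x Hx). cbv zeta in Hg3.
        rewrite forallb_forall in Hg3. specialize (Hg3 y Hy). rewrite Hin in Hg3; discriminate. }
      rewrite <- He. apply Hp. apply pairs_spec. repeat split; auto.
      apply unknown_spec; auto; apply Hk; auto. }
    intros x y Hx Hy. destruct (Nat.lt_trichotomy x y) as [H|[H|H]]; auto.
    - subst; apply E_irr.
    - rewrite E_sym; auto. }
  set (col := fun v => negb (existsb (fun i => if eqA v (f i) then true else false) c)).
  assert (Hcf : forall v, col v = false <-> exists i, In i c /\ v = f i).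
  { intros v. unfold col. rewrite negb_false_iff, existsb_exists. split.
    - intros [i [Hi H]]. exists i; split; auto. destruct (eqA v (f i)); [auto|discriminate].
    - intros [i [Hi H]]. exists i; split; auto. destruct (eqA v (f i)); auto. }
  destruct (Hcol col) as [i [Hi H]].
  - split.
    + intros u v _ _ He. destruct (col u) eqn:Hu; auto. destruct (col v) eqn:Hv; auto.
      apply Hcf in Hu, Hv. destruct Hu as [i [Hi ->]], Hv as [j [Hj ->]]. rewrite HE in He; auto.
    + intros u v w Hu Hv Hw HT. destruct (ts_all u v w Hu Hv Hw HT) as (a&b&d&Ht&Ha&Hb&Hd&Hc).
      specialize (Hg2 _ Ht). simpl in Hg2. rewrite !orb_true_iff, !existsb_eqb in Hg2.
      rewrite !Hcf.
      assert (Hex : exists i, In i c /\ (i = a \/ i = b \/ i = d)).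
      { destruct Hg2 as [[?|?]|?]; eauto. }
      destruct Hex as [i [Hi Hi']]. specialize (Hc i Hi').
      destruct Hc as [<-|[<-|<-]]; eauto.
  - rewrite <- f_f0 in H by auto. apply Hcf in H. destruct H as [j [Hj H]].
    destruct (Hk j Hj). apply f_inj in H; lia.
Qed.

Lemma no_ok_addno x y no : no_ok no -> E (f x) (f y) = false -> no_ok (addno x y no).
Proof.
  intros [Hl H] He. unfold addno. split; [rewrite !upd_length; auto|].
  intros i j. rewrite nth_upd, nth_upd.
  rewrite nth_upd.
  repeat match goal with |- context [if ?b then _ else _] => destruct b eqn:? end;
  rewrite ?mem_union, ?mem_bit, ?orb_true_iff; intros Hor;
  repeat match goal with h : (_ && _) = true |- _ => apply andb_true_iff in h; destruct h end;
  repeat match goal with h : (_ =? _) = true |- _ => apply Nat.eqb_eq in h; subst end; auto;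
  repeat (destruct Hor as [Hor|Hor]);
  repeat match goal with h : (_ =? _) = true |- _ => apply Nat.eqb_eq in h; subst end; auto;
  rewrite E_sym; auto.
Qed.

Lemma add_edges_sound fuel : forall first rows no, rows_ok k f rows -> no_ok no ->
  add_edges main s fuel k ts first rows no = true -> False.
Proof.
  induction fuel as [|fuel IH]; intros first rows no Hr Hno; [discriminate|].
  cbn [add_edges]. set (unk := unknown k rows no).
  destruct (if main then _ else false) eqn:Hd.
  { intros _. destruct main; [|discriminate]. specialize (Hdeg eq_refl).
    apply existsb_exists in Hd. destruct Hd as [[u r] [Hin H]].
    assert (Hlu : length unk = k) by (apply unknown_length; [apply Hr | apply Hno]).
    pose proof (ro_len _ _ _ Hr) as Hlr.
    apply (In_nth _ _ (B0, no_nbrs)) in Hin. destruct Hin as [i [Hi Hin]].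
    rewrite length_combine in Hi. rewrite combine_nth in Hin by lia.
    injection Hin as Hu Hrr. simpl in H.
    fold (nbrs rows i) in Hrr. subst r.
    destruct (snd (nbrs rows i)) as [|a [|b [|? ?]]] eqn:Hs; try discriminate.
    destruct (Hdeg (f i) (f a) (f b)) as [v (Hv&He&Hva&Hvb)]; [apply f_V; lia|].
    destruct (f_cover v Hv) as [j [Hj ->]].
    assert (Ht : mem (nth i unk B0) j = true).
    { apply unknown_spec; auto; [lia|]. rewrite Hs. intros [<-|[<-|[]]]; congruence. }
    rewrite Hu, is_empty_mem in Ht; auto; discriminate. }
  destruct (findcol _ _ _ _) as [c|]; [|discriminate].
  destruct (goodcol _ _ _ _ _) eqn:Hg; [|discriminate].
  assert (Hgo : forall ps no, no_ok no -> (forall x y, In (x, y) ps -> x < k /\ y < k) ->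
    add_edges_among (add_edges main s fuel k ts false) rows ps no = true ->
    forall x y, In (x, y) ps -> E (f x) (f y) = false).
  { clear Hno Hg unk Hd. induction ps as [|[x y] ps IHps]; intros no' Hno Hps; simpl; [tauto|].
    destruct (add_edges _ _ _ _ _ _ (addedge x y rows) no') eqn:Hp; [|discriminate].
    destruct (Hps x y) as [Hx Hy]; [left; auto|].
    assert (He : E (f x) (f y) = false).
    { destruct (E (f x) (f y)) eqn:He; auto. exfalso.
      eapply (IH false); [| |exact Hp]; auto. apply rows_ok_addedge; auto. }
    intros Hgo x' y' [Heq|Hin].
    - injection Heq as <- <-; auto.
    - eapply IHps; [| |exact Hgo|exact Hin]; auto using no_ok_addno.
      intros; apply Hps; right; auto. }
  assert (Hpk : forall x y, In (x, y) (pairs unk c) -> x < k /\ y < k).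
  { intros x y H. apply pairs_spec in H. destruct H as (Hx&Hy&_).
    unfold goodcol in Hg. rewrite !andb_true_iff in Hg. destruct Hg as [[Hg _] _].
    rewrite forallb_forall in Hg. apply Hg in Hx, Hy.
    rewrite andb_true_iff, Nat.ltb_lt in Hx, Hy. tauto. }
  intros H. apply (goodcol_sound rows no c Hr Hno Hg). fold unk.
  destruct (pairs unk c) as [|p ps] eqn:Hps; [intros ? ? []|].
  destruct (if first then _ else false) eqn:HX.
  - exfalso. destruct first; [|discriminate]. destruct (_ <=? _); [|discriminate].
    eapply hasX_sound; eauto.
  - eapply Hgo; eauto.
Qed.
End Leaf.

(** * Growth of the triangle system: triangle degrees, caps and invariants *)

Definition trinb (v u : A) : bool := E v u && existsb (fun w => E v w && E u w) V.
(** By [Tri_unique] this is twice the number of triangles at [v], directly comparable with the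
    number of listed neighbours of a label. *)
Definition tdeg (v : A) : nat := length (filter (trinb v) V).

Hypothesis Htri : forall v, In v V -> exists u w, In u V /\ In w V /\ Tri v u w.
Hypothesis Hdeg : main = true -> forall v a b, In v V -> exists u, In u V /\ E v u = true /\ u <> a /\ u <> b.
Hypothesis Hiso : main = true -> forall p q r, In p V -> In q V -> In r V -> Tri p q r ->
  exists x u w, (x = p \/ x = q \/ x = r) /\ In u V /\ In w V /\ Tri x u w /\ u <> p /\ u <> q /\ u <> r.
Hypothesis Hsep : s = 2 -> E (f0 0) (f0 1) = false /\
  forall w, In w V -> E (f0 0) w = true -> E (f0 1) w = false.
Hypothesis Hmany : exists W, NoDup W /\ incl W V /\ tmin <= length W /\
  forall x y, In x W -> In y W -> E x y = false.

Lemma trinb_spec v u : trinb v u = true <-> exists w, In w V /\ Tri v u w.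
Proof.
  unfold trinb. rewrite andb_true_iff, existsb_exists. split.
  - intros [H [w [Hw H']]]. rewrite andb_true_iff in H'. exists w. unfold Tri. tauto.
  - intros [w [Hw (?&?&?)]]. split; auto. exists w. rewrite andb_true_iff. auto.
Qed.

(** Selects the vertex behind a new component root, or behind the first label of a new pair;
    maximality justifies the caps given to the labels that follow. *)
Lemma max_exists (P : A -> Prop) : (exists v, In v V /\ P v) ->
  exists v, In v V /\ P v /\ forall u, In u V -> P u -> tdeg u <= tdeg v.
Proof.
  intros [v [Hv HP]].
  assert (Hb : forall u, tdeg u <= length V) by (intros; apply filter_length_le).
  remember (length V - tdeg v) as n eqn:Heq. revert v Hv HP Heq.
  induction n as [n IH] using lt_wf_ind. intros v Hv HP Heq.
  destruct (classic (exists u, In u V /\ P u /\ tdeg v < tdeg u)) as [[u (Hu&HPu&Hl)]|Hno].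
  - apply (IH (length V - tdeg u)) with u; auto. specialize (Hb u). lia.
  - exists v; repeat split; auto. intros u Hu HPu.
    destruct (le_lt_dec (tdeg u) (tdeg v)); auto. exfalso; eauto.
Qed.

Definition inT (i : nat) (t : tri) : Prop := let '(a, b, c) := t in i = a \/ i = b \/ i = c.
Definition triOK (k : nat) (f : nat -> A) (t : tri) : Prop :=
  let '(a, b, c) := t in a < k /\ b < k /\ c < k /\ Tri (f a) (f b) (f c).

(** [f] sends each label to its vertex in the hypothetical graph. By [i_adj] the rows contain only
    neighbours within triangles found so far, and [i_root] bounds the vertices that have no label
    yet. *)
Record Inv (z : st) (f : nat -> A) : Prop := {
  i_rows : rows_ok (sk z) f (srows z);
  i_nd : forall i, NoDup (snd (nbrs (srows z) i));
  i_caplen : length (scaps z) = sk z;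
  i_cap : forall b, b < sk z -> nth b (scaps z) 0 < sk z /\ tdeg (f b) <= tdeg (f (nth b (scaps z) 0));
  i_inj : forall i j, i < sk z -> j < sk z -> f i = f j -> i = j;
  i_V : forall i, i < sk z -> In (f i) V;
  i_s : s <= sk z;
  i_f0 : forall i, i < s -> f i = f0 i;
  i_tri : forall t, In t (stris z) -> triOK (sk z) f t;
  i_adj : forall i j, In j (snd (nbrs (srows z) i)) <->
            i <> j /\ exists t, In t (stris z) /\ inT i t /\ inT j t;
  i_root : match sroot z with
    | None => True
    | Some r => r < sk z /\ forall v, In v V -> (forall i, i < sk z -> f i <> v) -> tdeg v <= tdeg (f r)
    end }.

Definition out (z : st) (f : nat -> A) (v : A) : Prop := forall i, i < sk z -> f i <> v.
Definition Closed (z : st) (f : nat -> A) (x : nat) : Prop := forall i, i < x -> i < sk z ->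
  forall u w, In u V -> In w V -> Tri (f i) u w -> exists j, In j (snd (nbrs (srows z) i)) /\ u = f j.
Definition Part (z : st) (f : nat -> A) (x y : nat) : Prop := forall j, x < j -> j < y -> j < sk z ->
  (exists w, In w V /\ Tri (f x) (f j) w) -> In j (snd (nbrs (srows z) x)).
Definition capOK (z : st) (f : nat -> A) (c : option nat) (v : A) : Prop :=
  match c with None => True | Some c => c < sk z /\ tdeg v <= tdeg (f c) end.

Lemma in_range_or_out z f v : (exists i, i < sk z /\ v = f i) \/ out z f v.
Proof.
  destruct (classic (exists i, i < sk z /\ v = f i)) as [H|H]; auto.
  right. intros i Hi <-. eauto.
Qed.

Lemma Inv_ext z f f' : (forall i, i < sk z -> f i = f' i) -> Inv z f -> Inv z f'.
Proof.
  intros Hf [H1 H2 H3 H4 H5 H6 H7 H8 H9 H10 H11]. split; auto.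
  - eapply rows_ok_ext; eauto.
  - intros b Hb. destruct (H4 b Hb). rewrite <- !Hf; auto.
  - intros i j Hi Hj. rewrite <- !Hf; auto.
  - intros i Hi. rewrite <- Hf; auto.
  - intros i Hi. rewrite <- Hf; auto. lia.
  - intros [[a b] c] Ht. destruct (H9 _ Ht) as (?&?&?&?). simpl. rewrite <- !Hf; auto.
  - destruct (sroot z) as [r|]; auto. destruct H11 as [Hr H11]. split; auto.
    rewrite <- Hf by auto. intros v Hv Ho. apply H11; auto.
    intros i Hi. rewrite Hf; auto.
Qed.

Lemma nbrs_app rows i : nbrs (rows ++ [no_nbrs]) i = nbrs rows i.
Proof.
  unfold nbrs. destruct (Nat.lt_ge_cases i (length rows)).
  - apply app_nth1; auto.
  - rewrite app_nth2, (nth_overflow rows) by auto.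
    destruct (i - length rows) as [|[|n]]; auto.
Qed.

Lemma addlab_Inv z f c : Inv z f -> In (f (sk z)) V -> out z f (f (sk z)) ->
  capOK z f c (f (sk z)) -> Inv (addlab z c) f.
Proof.
  intros [H1 H2 H3 H4 H5 H6 H7 H8 H9 H10 H11] HVk Ho Hc.
  split; unfold addlab; cbn [sk srows scaps stris sroot]; auto.
  - destruct H1 as [R1 R2 R3 R4]. split.
    + rewrite length_app; simpl; lia.
    + intros; rewrite nbrs_app; auto.
    + intros i j. rewrite nbrs_app. intros H; apply R3 in H. intuition lia.
    + intros i j. rewrite !nbrs_app; auto.
  - intros; rewrite nbrs_app; auto.
  - rewrite length_app; simpl; lia.
  - intros b Hb. destruct (Nat.eq_dec b (sk z)) as [->|Hne].
    + rewrite app_nth2, H3, Nat.sub_diag by lia. simpl. destruct c; simpl in Hc; lia.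
    + rewrite app_nth1 by lia. destruct (H4 b); lia.
  - intros i j Hi Hj Heq. destruct (Nat.eq_dec i (sk z)) as [->|]; destruct (Nat.eq_dec j (sk z)) as [->|]; auto.
    + exfalso; apply (Ho j); [lia|auto].
    + exfalso; apply (Ho i); [lia|auto].
    + apply H5; auto; lia.
  - intros i Hi. destruct (Nat.eq_dec i (sk z)) as [->|]; auto. apply H6; lia.
  - intros [[a b] d] Ht. destruct (H9 _ Ht) as (?&?&?&?). simpl. intuition lia.
  - intros i j; rewrite nbrs_app; auto.
  - destruct (sroot z); auto. destruct H11 as [Hr H11]; split; [lia|].
    intros v Hv Hov. apply H11; auto.
Qed.

Lemma addtri_list z f a b c m l : Inv z f -> a < sk z -> b < sk z -> c < sk z ->
  Tri (f a) (f b) (f c) ->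
  In l (snd (nbrs (srows (addtri z a b c)) m)) <->
  (m <> l /\ inT m (a, b, c) /\ inT l (a, b, c)) \/ In l (snd (nbrs (srows z) m)).
Proof.
  intros HI Ha Hb Hc (E1&E2&E3). pose proof (ro_len _ _ _ (i_rows _ _ HI)) as Hl.
  assert (a <> b) by (intros ->; rewrite E_irr in E1; discriminate).
  assert (a <> c) by (intros ->; rewrite E_irr in E2; discriminate).
  assert (b <> c) by (intros ->; rewrite E_irr in E3; discriminate).
  simpl. rewrite !(addedge_in (sk z)); rewrite ?addedge_length; auto.
  intuition (subst; auto; try lia; try contradiction).
Qed.

Lemma NoDup_addedge k rows i j : length rows = k -> i < k -> j < k -> i <> j ->
  ~ In j (snd (nbrs rows i)) -> ~ In i (snd (nbrs rows j)) ->
  (forall m, NoDup (snd (nbrs rows m))) -> forall m, NoDup (snd (nbrs (addedge i j rows) m)).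
Proof.
  intros Hl Hi Hj Hij H1 H2 H m. unfold addedge.
  rewrite nbrs_add_nbr by (unfold add_nbr; rewrite upd_length; lia). rewrite !nbrs_add_nbr by lia.
  destruct (Nat.eqb_spec m i); destruct (Nat.eqb_spec m j); destruct (Nat.eqb_spec i j); subst; simpl; try lia; auto;
  constructor; auto.
Qed.

Lemma addtri_Inv z f a b c : Inv z f -> a < sk z -> b < sk z -> c < sk z ->
  Tri (f a) (f b) (f c) ->
  ~ In b (snd (nbrs (srows z) a)) -> ~ In c (snd (nbrs (srows z) a)) -> ~ In c (snd (nbrs (srows z) b)) ->
  Inv (addtri z a b c) f.
Proof.
  intros HI Ha Hb Hc HT Hab Hac Hbc.
  pose proof (fun m l => addtri_list z f a b c m l HI Ha Hb Hc HT) as HL.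
  destruct HT as (E1&E2&E3).
  assert (Nab : a <> b) by (intros ->; rewrite E_irr in E1; discriminate).
  assert (Nac : a <> c) by (intros ->; rewrite E_irr in E2; discriminate).
  assert (Nbc : b <> c) by (intros ->; rewrite E_irr in E3; discriminate).
  destruct HI as [H1 H2 H3 H4 H5 H6 H7 H8 H9 H10 H11].
  assert (Hs : forall i j, ~ In j (snd (nbrs (srows z) i)) -> ~ In i (snd (nbrs (srows z) j))).
  { intros i j Hn' Hin; apply Hn'. apply (ro_sym _ _ _ H1); auto. }
  pose proof (ro_len _ _ _ H1) as Hlen.
  split; cbn [sk scaps sroot]; auto.
  - simpl. repeat apply rows_ok_addedge; auto.
  - simpl.
    apply (NoDup_addedge (sk z)); rewrite ?addedge_length; auto;
      rewrite ?(addedge_in (sk z)); rewrite ?addedge_length; auto;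
      [ pose proof (Hs _ _ Hab); intuition (subst; auto; lia) .. |].
    apply (NoDup_addedge (sk z)); rewrite ?addedge_length; auto;
      rewrite ?(addedge_in (sk z)); rewrite ?addedge_length; auto;
      [ pose proof (Hs _ _ Hac); intuition (subst; auto; lia) .. |].
    apply (NoDup_addedge (sk z)); auto.
  - intros t [<-|Ht]; [|apply H9; auto]. repeat split; auto.
  - intros i j. rewrite HL, H10. simpl stris. split.
    + intros [(Hne&Hi&Hj)|(Hne&t&Ht&Hi&Hj)]; split; auto.
      * exists (a, b, c); split; [left|]; auto.
      * exists t; split; [right|]; auto.
    + intros (Hne&t&Ht&Hi&Hj). destruct Ht as [<-|Ht]; [left|right]; eauto 10.
Qed.

Lemma Closed_mono z z' f x : sk z <= sk z' -> 
  (forall i j, In j (snd (nbrs (srows z) i)) -> In j (snd (nbrs (srows z') i))) ->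
  x <= sk z -> Closed z f x -> Closed z' f x.
Proof.
  intros Hk Hm Hx HC i Hi Hi' u w Hu Hw HT.
  destruct (HC i Hi ltac:(lia) u w Hu Hw HT) as [j [Hj ->]]. eauto.
Qed.

Lemma tri_third k f t i j : triOK k f t -> inT i t -> inT j t -> i <> j ->
  exists l, l < k /\ inT l t /\ Tri (f i) (f j) (f l).
Proof.
  destruct t as [[a b] c]. intros (Ha&Hb&Hc&HT) Hi Hj Hne. simpl in *.
  destruct Hi as [->| [->| ->]], Hj as [->| [->| ->]]; try lia.
  - exists c; auto.
  - exists b; auto using Tri_132.
  - exists c; auto using Tri_213.
  - exists a. repeat split; auto; apply HT || apply E_comm; apply HT.
  - exists b. repeat split; auto; apply HT || apply E_comm; apply HT.
  - exists a. repeat split; auto; apply HT || apply E_comm; apply HT.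
Qed.

Lemma listed_third z f i j w : Inv z f -> In j (snd (nbrs (srows z) i)) -> Tri (f i) (f j) w ->
  exists l t, In t (stris z) /\ inT i t /\ inT j t /\ inT l t /\ w = f l /\ In l (snd (nbrs (srows z) i)).
Proof.
  intros HI Hj HT. apply (i_adj _ _ HI) in Hj. destruct Hj as (Hne&t&Ht&Hi&Hj).
  destruct (tri_third _ _ _ _ _ (i_tri _ _ HI _ Ht) Hi Hj Hne) as (l&Hl&Hlt&HT').
  exists l, t. repeat split; auto.
  - eapply Tri_unique; eauto.
  - apply (i_adj _ _ HI). split; [|exists t; auto].
    intros ->. destruct HT' as (_&HT'&_). rewrite E_irr in HT'; discriminate.
Qed.

Lemma nnbrs_le_tdeg z f i : Inv z f -> i < sk z -> nnbrs z i <= tdeg (f i).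
Proof.
  intros HI Hi. unfold nnbrs, tdeg. rewrite <- (length_map f).
  apply NoDup_incl_length.
  - apply NoDup_map_NoDup_ForallPairs; [|apply (i_nd _ _ HI)].
    intros a b Ha Hb. apply (ro_E _ _ _ (i_rows _ _ HI)) in Ha, Hb. apply (i_inj _ _ HI); tauto.
  - intros v Hv. apply in_map_iff in Hv. destruct Hv as [j [<- Hj]].
    apply filter_In. split.
    + apply (ro_E _ _ _ (i_rows _ _ HI)) in Hj. apply (i_V _ _ HI); tauto.
    + apply trinb_spec. apply (i_adj _ _ HI) in Hj. destruct Hj as (Hne&t&Ht&Hit&Hjt).
      destruct (tri_third _ _ _ _ _ (i_tri _ _ HI _ Ht) Hit Hjt Hne) as (l&Hl&Hlt&HT').
      exists (f l); split; auto. apply (i_V _ _ HI); auto.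
Qed.

Lemma tdeg_le_nnbrs z f x i : Inv z f -> Closed z f x -> i < x -> i < sk z -> tdeg (f i) <= nnbrs z i.
Proof.
  intros HI HC Hi Hk. unfold nnbrs, tdeg. rewrite <- (length_map f).
  apply NoDup_incl_length; [apply NoDup_filter; auto|].
  intros v Hv. apply filter_In in Hv. destruct Hv as [Hv Ht].
  apply trinb_spec in Ht. destruct Ht as [w [Hw HT]].
  destruct (HC i Hi Hk v w Hv Hw HT) as [j [Hj ->]]. apply in_map; auto.
Qed.

Lemma below_cap_sound z f x : Inv z f -> Closed z f x -> forall fuel b n, b < sk z ->
  n <= tdeg (f b) -> below_cap z x n b fuel = true.
Proof.
  intros HI HC. induction fuel as [|fuel IH]; intros b n Hb Hle; simpl; auto.
  destruct (i_cap _ _ HI b Hb) as [Hc Hg].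
  destruct (_ =? b); auto. destruct (Nat.ltb_spec (nth b (scaps z) 0) x).
  - apply Nat.leb_le. pose proof (tdeg_le_nnbrs z f x _ HI HC H Hc). lia.
  - apply IH; auto. lia.
Qed.

Lemma cap_ok_sound z f x b : Inv z f -> Closed z f x -> b < sk z -> cap_ok z x b = true.
Proof. intros HI HC Hb. unfold cap_ok. eapply below_cap_sound; eauto. apply nnbrs_le_tdeg; auto. Qed.

Definition modeOK (z : st) (f : nat -> A) (m : mode) : Prop :=
  match m with
  | Next x => x <= sk z /\ Closed z f x
  | Dec x y b3 => x < sk z /\ x < y /\ Closed z f x /\ Part z f x y /\ b3 = ball3 (srows z) x
  | Fresh x c => x < sk z /\ Closed z f x /\ Part z f x (sk z) /\
      match c with None => True | Some c => c < sk z /\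
        forall u w, In u V -> In w V -> out z f u -> out z f w -> Tri (f x) u w -> tdeg u <= tdeg (f c) end
  end.

Lemma in_range z f i j : Inv z f -> In j (snd (nbrs (srows z) i)) -> j < sk z.
Proof. intros HI H. apply (ro_E _ _ _ (i_rows _ _ HI)) in H; tauto. Qed.

(** For [j] below [x] the triangle was found when [j] was closed, for [j] above [x] when the pair
    was decided. *)
Lemma inner_listed z f x j w : Inv z f -> Closed z f x -> Part z f x (sk z) -> x < sk z -> j < sk z ->
  In w V -> Tri (f x) (f j) w -> In j (snd (nbrs (srows z) x)).
Proof.
  intros HI HC HP Hx Hj Hw HT. destruct (Nat.lt_trichotomy j x) as [H| [->|H]].
  - destruct (HC j H Hj (f x) w) as [l [Hl Heq]]; auto using Tri_213.
    + apply (i_V _ _ HI); auto.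
    + apply (i_inj _ _ HI) in Heq; eauto using in_range. subst.
      apply (ro_sym _ _ _ (i_rows _ _ HI)); auto.
  - destruct HT as (HT&_). rewrite E_irr in HT; discriminate.
  - apply HP; eauto.
Qed.

(** A triangle at [x] with one more labelled vertex is known by [inner_listed], and its third vertex
    with it by [listed_third]. Only two unlabelled vertices could escape. *)
Lemma close_sound z f x : Inv z f -> Closed z f x -> Part z f x (sk z) -> x < sk z ->
  ~ (exists u w, In u V /\ In w V /\ out z f u /\ out z f w /\ Tri (f x) u w) -> Closed z f (S x).
Proof.
  intros HI HC HP Hx Hno i Hi Hk u w Hu Hw HT.
  destruct (Nat.eq_dec i x) as [->|Hne]; [|apply (HC i ltac:(lia) Hk u w); auto].
  destruct (in_range_or_out z f u) as [[j [Hj ->]]|Ho].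
  - exists j; split; auto. eapply inner_listed; eauto.
  - destruct (in_range_or_out z f w) as [[j [Hj ->]]|Ho'].
    + assert (In j (snd (nbrs (srows z) x))) by (apply (inner_listed z f x j u); auto using Tri_132).
      destruct (listed_third z f x j u HI H (Tri_132 _ _ _ HT)) as (l&t&_&_&_&_&->&Hl). eauto.
    + exfalso; apply Hno; eauto 10.
Qed.

Lemma leaf_sound z f : Inv z f -> Closed z f (sk z) ->
  (forall v, In v V -> exists i, i < sk z /\ v = f i) -> leaf main s tmin z = true -> False.
Proof.
  intros HI HC Hcov. unfold leaf.
  assert (HL : forall u v w, In u V -> In v V -> In w V -> Tri u v w ->
    exists t i j l, In t (stris z) /\ inT i t /\ inT j t /\ inT l t /\ u = f i /\ v = f j /\ w = f l).
  { intros u v w Hu Hv Hw HT. destruct (Hcov u Hu) as [i [Hi ->]].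
    destruct (HC i Hi Hi v w Hv Hw HT) as [j [Hj ->]].
    destruct (listed_third z f i j w HI Hj HT) as (l&t&Ht&Hit&Hjt&Hlt&->&_).
    exists t, i, j, l. auto 10. }
  destruct (Nat.ltb_spec (length (stris z)) tmin) as [Hl|Hl].
  { intros _. destruct Hmany as (W&HW&Hinc&Hlen&Hind).
    assert (length W <= length (stris z)); [|lia].
    (* Two vertices of an independent set never share a triangle, so [W] uses [length W] different
       triangles. *)
    apply (pigeon (fun w t => In t (stris z) /\ exists i, inT i t /\ w = f i)); auto.
    - intros w Hw. destruct (Htri w (Hinc w Hw)) as (u&v&Hu&Hv&HT).
      destruct (HL w u v (Hinc w Hw) Hu Hv HT) as (t&i&j&l&Ht&Hi&_&_&->&_). eauto 10.
    - intros w w' t Hw Hw' [Ht [i [Hi ->]]] [_ [j [Hj ->]]].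
      destruct (Nat.eq_dec i j) as [->|Hne]; auto. exfalso.
      destruct (tri_third _ _ _ _ _ (i_tri _ _ HI _ Ht) Hi Hj Hne) as (l&_&_&HT&_).
      rewrite Hind in HT; auto; discriminate. }
  destruct (if main then _ else false) eqn:His.
  { intros _. destruct main; [|discriminate].
    apply existsb_exists in His. destruct His as [[[a b] c] [Ht H]].
    pose proof (i_tri _ _ HI _ Ht) as (Ha&Hb&Hc&HT). simpl in H.
    rewrite !andb_true_iff, !Nat.eqb_eq in H. destruct H as [[La Lb] Lc].
    assert (Hx : forall x, inT x (a, b, c) -> nnbrs z x = 2) by (intros x [->| [->| ->]]; auto).
    destruct (Hiso eq_refl (f a) (f b) (f c)) as (x&u&w&Hxx&Hu&Hw&HTx&N1&N2&N3);
      try apply (i_V _ _ HI); auto.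
    assert (Hex : exists i, inT i (a, b, c) /\ x = f i) by (destruct Hxx as [->| [->| ->]]; simpl; eauto).
    destruct Hex as [i [Hi ->]].
    assert (Hik : i < sk z) by (destruct Hi as [->| [->| ->]]; auto).
    destruct (HC i Hik Hik u w Hu Hw HTx) as [j [Hj ->]].
    (* The label [i] has only two listed neighbours, and the other two corners are among them. So
       [j] must be a corner, although [f j] is none. *)
    assert (Hjt : inT j (a, b, c)).
    { set (L := filter (fun m => negb (m =? i)) [a; b; c]).
      assert (Hab : a <> b) by (intros ->; destruct HT as (HT&_); rewrite E_irr in HT; discriminate).
      assert (Hac : a <> c) by (intros ->; destruct HT as (_&HT&_); rewrite E_irr in HT; discriminate).
      assert (Hbc : b <> c) by (intros ->; destruct HT as (_&_&HT); rewrite E_irr in HT; discriminate).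
      assert (Hincl : incl L (snd (nbrs (srows z) i))).
      { intros m Hm. apply filter_In in Hm. destruct Hm as [Hm Hmi].
        apply negb_true_iff, Nat.eqb_neq in Hmi.
        apply (i_adj _ _ HI). split; auto. exists (a, b, c). split; auto. split; auto.
        simpl in Hm |- *. intuition. }
      assert (HndL : NoDup L).
      { apply NoDup_filter. repeat constructor; simpl; intuition. }
      assert (HlL : 2 <= length L).
      { unfold L. simpl. destruct Hi as [->| [->| ->]]; rewrite ?Nat.eqb_refl;
        repeat match goal with |- context [?p =? ?q] => destruct (Nat.eqb_spec p q); try lia end; simpl; lia. }
      assert (Hjl : In j L).
      { eapply NoDup_length_incl; [exact HndL| |exact Hincl|exact Hj].
        specialize (Hx i Hi). unfold nnbrs in Hx. lia. }
      apply filter_In in Hjl. simpl in Hjl |- *. intuition. }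
    destruct Hjt as [->| [->| ->]]; contradiction. }
  apply (add_edges_sound (sk z) f (rev (stris z))); auto.
  - apply (i_inj _ _ HI).
  - apply (i_V _ _ HI).
  - apply (i_s _ _ HI).
  - apply (i_f0 _ _ HI).
  - intros u v w Hu Hv Hw HT. destruct (HL u v w Hu Hv Hw HT) as ([[a b] c]&i&j&l&Ht&Hi&Hj&Hlt&->&->&->).
    pose proof (i_tri _ _ HI _ Ht) as (Ha&Hb&Hc&HTt).
    exists a, b, c. split; [apply in_rev in Ht; auto|]. repeat split; auto.
    intros m Hm. destruct HT as (E1&E2&E3).
    assert (i <> j) by (intros ->; rewrite E_irr in E1; discriminate).
    assert (i <> l) by (intros ->; rewrite E_irr in E2; discriminate).
    assert (j <> l) by (intros ->; rewrite E_irr in E3; discriminate).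
    simpl in Hi, Hj, Hlt. intuition (subst; auto; lia).
  - apply (i_rows _ _ HI).
  - split; [rewrite length_map; apply (ro_len _ _ _ (i_rows _ _ HI))|].
    intros i j. assert (Hn0 : forall (l : list row) n, nth n (map (fun _ => B0) l) B0 = B0).
    { induction l; intros [|n]; simpl; auto. }
    rewrite Hn0. discriminate.
Qed.

Definition relabel (f : nat -> A) (k : nat) (v : A) : nat -> A := fun i => if i =? k then v else f i.

Lemma relabel_old f k v i : i < k -> relabel f k v i = f i.
Proof. intros H. unfold relabel. destruct (Nat.eqb_spec i k); auto; lia. Qed.
Lemma relabel_new f k v : relabel f k v k = v.
Proof. unfold relabel. rewrite Nat.eqb_refl; auto. Qed.

Lemma out_relabel z f v v' : out z f v' -> out z (relabel f (sk z) v) v'.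
Proof. intros H i Hi. rewrite relabel_old; auto. Qed.

Lemma relabel_Inv z f v c : Inv z f -> In v V -> out z f v -> capOK z f c v ->
  Inv (addlab z c) (relabel f (sk z) v).
Proof.
  intros HI Hv Ho Hc. apply addlab_Inv; rewrite ?relabel_new; auto using out_relabel.
  - eapply Inv_ext; [|exact HI]. intros; rewrite relabel_old; auto.
  - destruct c; auto. destruct Hc. split; auto. rewrite relabel_old; auto.
Qed.

Lemma Closed_relabel z f x v c : Inv z f -> x <= sk z -> Closed z f x -> Closed (addlab z c) (relabel f (sk z) v) x.
Proof.
  intros HI Hx HC i Hi Hk u w Hu Hw HT. simpl in *. rewrite nbrs_app.
  rewrite relabel_old in HT by lia.
  destruct (HC i Hi ltac:(lia) u w Hu Hw HT) as [j [Hj ->]]. exists j; split; auto.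
  rewrite relabel_old; eauto using in_range.
Qed.

Lemma Part_relabel z f x y v c : x < sk z -> y <= sk z -> Part z f x y -> Part (addlab z c) (relabel f (sk z) v) x y.
Proof.
  intros Hx Hy HP j H1 H2 Hk [w [Hw HT]]. simpl in *. rewrite nbrs_app.
  rewrite !relabel_old in HT by lia. apply HP; eauto; lia.
Qed.

Lemma out_lt z f v : Inv z f -> In v V -> out z f v -> sk z < nmax.
Proof.
  intros HI Hv Ho. apply Nat.lt_le_trans with (length V); auto.
  assert (H : length (v :: map f (seq 0 (sk z))) <= length V).
  { apply NoDup_incl_length.
    - constructor.
      + intros H. apply in_map_iff in H. destruct H as [i [Hi H]]. apply in_seq in H.
        apply (Ho i); auto; lia.
      + apply NoDup_map_NoDup_ForallPairs; [|apply seq_NoDup].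
        intros a b Ha Hb. apply in_seq in Ha, Hb. apply (i_inj _ _ HI); lia.
    - intros u [<-|Hu]; auto. apply in_map_iff in Hu. destruct Hu as [i [<- H]].
      apply in_seq in H. apply (i_V _ _ HI); lia. }
  simpl in H. rewrite length_map, length_seq in H. lia.
Qed.

Lemma root_cap z f v : Inv z f -> In v V -> out z f v -> capOK z f (sroot z) v.
Proof.
  intros HI Hv Ho. pose proof (i_root _ _ HI) as H. destruct (sroot z); simpl; auto.
  destruct H; split; auto.
Qed.

Lemma not_in_row_new z f i : Inv z f -> ~ In (sk z) (snd (nbrs (srows z) i)).
Proof. intros HI H. apply (in_range _ _ _ _ HI) in H. lia. Qed.

Lemma step_sound fuel z f x y w :
  (forall z f m, Inv z f -> modeOK z f m -> explore main nmax s tmin fuel z m = true -> False) ->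
  Inv z f -> Closed z f x -> Part z f x y -> x < y -> y < sk z -> w < sk z ->
  Tri (f x) (f y) (f w) ->
  ~ In y (snd (nbrs (srows z) x)) -> ~ In w (snd (nbrs (srows z) x)) -> ~ In w (snd (nbrs (srows z) y)) ->
  (let z' := addtri z x y w in
    if cap_ok z' x x then if cap_ok z' x y then if cap_ok z' x w then
      explore main nmax s tmin fuel z' (Dec x (S y) (ball3 (srows z') x)) else true else true else true) = true -> False.
Proof.
  intros IH HI HC HP Hxy Hy Hw HT N1 N2 N3. cbv zeta.
  assert (HI' : Inv (addtri z x y w) f) by (apply addtri_Inv; auto; lia).
  assert (HL : forall m l, In l (snd (nbrs (srows z) m)) -> In l (snd (nbrs (srows (addtri z x y w)) m))).
  { intros m l H. rewrite (addtri_list z f) by (auto; lia). auto. }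
  assert (HC' : Closed (addtri z x y w) f x).
  { apply (Closed_mono z); auto. lia. }
  rewrite !(cap_ok_sound (addtri z x y w) f x) by (auto; simpl; lia).
  apply (IH _ f); auto. simpl modeOK. repeat split; auto; try (simpl; lia).
  intros j H1 H2 Hk He. destruct (Nat.eq_dec j y) as [->|Hne].
  - rewrite (addtri_list z f) by (auto; lia). left. simpl. lia.
  - apply HL, HP; auto. lia.
Qed.

(** At each node the hypothetical graph itself selects a branch, according to whether the triangle
    in question exists. That branch was refuted too, and the induction hypothesis applies after [f]
    has been extended to any new labels. *)
Lemma explore_sound fuel : forall z f m, Inv z f -> modeOK z f m -> explore main nmax s tmin fuel z m = true -> False.
Proof.
  induction fuel as [|fuel IH]; intros z f m HI HM; [discriminate|].
  destruct m as [x|x y b3|x c]; cbn [explore].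
  - destruct HM as [Hx HC]. destruct (Nat.ltb_spec x (sk z)) as [Hlt|Hge].
    + apply (IH _ f); auto. simpl. repeat split; auto. intros j; lia.
    + assert (x = sk z) by lia. subst x. intros H.
      destruct (match sk z with 0 => true | S _ => leaf main s tmin z end) eqn:Hleaf; [|discriminate].
      destruct (classic (forall v, In v V -> exists i, i < sk z /\ v = f i)) as [Hcov|Hncov].
      * destruct (sk z) eqn:Hk.
        { assert (HV0 : V = []).
          { destruct V as [|v l]; auto. destruct (Hcov v) as [i [Hi _]]; [left; auto|lia]. }
          destruct (Hcol (fun _ => true)) as [i [Hi _]].
          - rewrite HV0. split; simpl; tauto.
          - pose proof (i_s _ _ HI). lia. }
        rewrite <- Hk in HC, Hcov. eapply leaf_sound; eauto.
      * assert (Hex : exists v, In v V /\ out z f v).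
        { apply not_all_ex_not in Hncov. destruct Hncov as [v Hv].
          apply imply_to_and in Hv. destruct Hv as [Hv Hnv]. exists v; split; auto.
          destruct (in_range_or_out z f v); auto. contradiction. }
        destruct (max_exists (out z f) Hex) as (v&Hv&Ho&Hmax).
        pose proof (out_lt z f v HI Hv Ho) as Hlt. apply Nat.ltb_lt in Hlt. rewrite Hlt in H.
        pose proof (relabel_Inv z f v (sroot z) HI Hv Ho (root_cap z f v HI Hv Ho)) as HI1.
        set (f' := relabel f (sk z) v) in *.
        assert (HI2 : Inv (setroot (addlab z (sroot z)) (sk z)) f').
        { destruct HI1 as [H1 H2 H3 H4 H5 H6 H7 H8 H9 H10 H11]. split; auto.
          simpl. split; [lia|]. intros u Hu Hou. unfold f'. rewrite relabel_new. apply Hmax; auto.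
          intros i Hi. specialize (Hou i ltac:(simpl; lia)). unfold f' in Hou. rewrite relabel_old in Hou; auto. }
        revert H. apply (IH _ f'); auto. simpl modeOK. simpl sk. repeat split; try lia.
        -- apply (Closed_relabel z f _ v (sroot z) HI); auto.
        -- intros j; simpl; lia.
        -- intros u w Hu Hw Hou How HT. unfold f'. rewrite relabel_new. apply Hmax; auto.
           intros i Hi. specialize (Hou i ltac:(simpl; lia)). unfold f' in Hou. rewrite relabel_old in Hou; auto.
  - destruct HM as (Hx&Hxy&HC&HP&->).
    destruct (Nat.ltb_spec y (sk z)) as [Hy|Hy].
    + assert (Hskip : In y (snd (nbrs (srows z) x)) ->
          modeOK z f (Dec x (S y) (ball3 (srows z) x))).
      { intros Hin. simpl. repeat split; auto. intros j H1 H2 Hk He.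
        destruct (Nat.eq_dec j y) as [->|]; auto. apply HP; auto; lia. }
      assert (Hskip' : ~ (exists w, In w V /\ Tri (f x) (f y) w) ->
          modeOK z f (Dec x (S y) (ball3 (srows z) x))).
      { intros Hno. simpl. repeat split; auto. intros j H1 H2 Hk He.
        destruct (Nat.eq_dec j y) as [->|]; [contradiction|]. apply HP; auto; lia. }
      destruct (classic (exists w, In w V /\ Tri (f x) (f y) w)) as [Hex|Hno].
      2: { specialize (Hskip' Hno). destruct (mem (ball3 (srows z) x) y); [apply (IH z f); auto|].
           destruct (explore _ _ _ _ fuel z _) eqn:Hp; [|discriminate]. intros _. eapply IH; eauto. }
      destruct (mem (ball3 (srows z) x) y) eqn:Hb.
      { apply (IH z f); auto. apply Hskip; auto. destruct Hex as [w [_ (He&_)]].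
        eapply ball3_E; eauto using i_inj, i_rows. }
      assert (Nxy : ~ In y (snd (nbrs (srows z) x))).
      { intros Hin. apply (ball3_list _ _ _ _ _ (i_rows _ _ HI)) in Hin. congruence. }
      destruct Hex as [w [Hw HT]].
      destruct (explore _ _ _ _ fuel z _); [|discriminate].
      destruct (forallb _ _) eqn:Hfor; [|discriminate].
      destruct (in_range_or_out z f w) as [[l [Hl ->]]|Ho].
      * assert (Nyl : ~ In l (snd (nbrs (srows z) x))).
        { intros Hin. destruct (listed_third z f x l (f y) HI Hin (Tri_132 _ _ _ HT)) as (j&t&_&_&_&_&Heq&Hj).
          apply (i_inj _ _ HI) in Heq; eauto using in_range. subst; auto. }
        assert (Hyl : y < l).
        { destruct (Nat.lt_trichotomy l y) as [H|[->|H]]; auto; exfalso.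
          - apply Nyl. destruct (Nat.lt_trichotomy l x) as [H'|[->|H']].
            + destruct (HC l H' Hl (f x) (f y)) as [j [Hj Heq]]; auto.
              * apply (i_V _ _ HI); auto.
              * apply (i_V _ _ HI); auto.
              * apply Tri_213, Tri_132; auto.
              * apply (i_inj _ _ HI) in Heq; eauto using in_range. subst.
                apply (ro_sym _ _ _ (i_rows _ _ HI)); auto.
            + destruct HT as (_&HT&_). rewrite E_irr in HT; discriminate.
            + apply HP; auto. exists (f y). split; [apply (i_V _ _ HI); auto|]. apply Tri_132; auto.
          - destruct HT as (_&_&HT). rewrite E_irr in HT; discriminate. }
        intros _. rewrite forallb_forall in Hfor. specialize (Hfor l).
        rewrite mem_union in Hfor.
        assert (B1 : mem (ball3 (srows z) x) l = false).
        { destruct (mem (ball3 (srows z) x) l) eqn:B; auto. exfalso. apply Nyl.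
          eapply ball3_E; eauto using i_inj, i_rows. apply HT. }
        assert (Nyl' : ~ In l (snd (nbrs (srows z) y))).
        { intros Hin. destruct (listed_third z f y l (f x) HI Hin) as (j&t&Ht&_&Hlt&Hj&Heq&Hjy).
          - apply Tri_132, Tri_213; auto.
          - apply (i_inj _ _ HI) in Heq; eauto using in_range. subst.
            apply Nxy, (ro_sym _ _ _ (i_rows _ _ HI)); auto. }
        assert (B2 : mem (ball3 (srows z) y) l = false).
        { destruct (mem (ball3 (srows z) y) l) eqn:B; auto. exfalso. apply Nyl'.
          eapply ball3_E; eauto using i_inj, i_rows. apply HT. }
        rewrite B1, B2 in Hfor. simpl orb in Hfor.
        eapply (step_sound fuel z f x y l); eauto. apply Hfor. apply in_seq. lia.
      * pose proof (out_lt z f w HI Hw Ho) as Hlt. apply Nat.ltb_lt in Hlt. rewrite Hlt.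
        pose proof (relabel_Inv z f w (sroot z) HI Hw Ho (root_cap z f w HI Hw Ho)) as HI1.
        apply (step_sound fuel (addlab z (sroot z)) (relabel f (sk z) w) x y (sk z)); auto; simpl; try lia.
        -- apply Closed_relabel; auto. lia.
        -- apply (Part_relabel z f x y w (sroot z)); auto. lia.
        -- rewrite relabel_new, !relabel_old; auto.
        -- rewrite nbrs_app; auto.
        -- rewrite nbrs_app. apply (not_in_row_new z f); auto.
        -- rewrite nbrs_app. apply (not_in_row_new z f); auto.
    + apply (IH z f); auto. simpl. repeat split; auto.
      * intros j H1 H2 Hk. apply HP; auto; lia.
      * pose proof (i_root _ _ HI) as Hr. destruct (sroot z); auto.
        destruct Hr; split; auto.
  - destruct HM as (Hx&HC&HP&Hc).
    destruct (classic (exists u, In u V /\ (out z f u /\ exists w, In w V /\ out z f w /\ Tri (f x) u w))) as [Hex|Hno].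
    + destruct (match nnbrs z x with 0 => true | _ => _ end); [|discriminate].
      destruct (max_exists _ Hex) as (u&Hu&(Hou&w&Hw&How&HT)&Hmax).
      set (f1 := relabel f (sk z) u).
      assert (HI1 : Inv (addlab z c) f1).
      { apply relabel_Inv; auto. destruct c; simpl; auto. destruct Hc; split; eauto. }
      assert (How1 : out (addlab z c) f1 w).
      { intros i Hi. simpl in Hi. destruct (Nat.eq_dec i (sk z)) as [->|].
        - unfold f1. rewrite relabel_new. destruct HT as (_&_&HT). apply E_neq; auto.
        - unfold f1. rewrite relabel_old by lia. apply How; lia. }
      set (f2 := relabel f1 (S (sk z)) w).
      assert (HI2 : Inv (addlab (addlab z c) (Some (sk z))) f2).
      { apply (relabel_Inv (addlab z c) f1 w (Some (sk z))); auto. simpl. split; [lia|].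
        unfold f1. rewrite relabel_new. apply Hmax; auto. split; auto. exists u. split; auto. split; auto. apply Tri_132; auto. }
      pose proof (out_lt _ _ _ HI1 Hw How1) as Hlt. apply Nat.ltb_lt in Hlt. simpl sk in Hlt. rewrite Hlt.
      assert (F0 : forall i, i < sk z -> f2 i = f i).
      { intros i Hi. unfold f2, f1. rewrite !relabel_old; auto. }
      assert (F1 : f2 (sk z) = u).
      { unfold f2, f1. rewrite relabel_old, relabel_new; auto. }
      assert (F2 : f2 (S (sk z)) = w) by apply relabel_new.
      assert (HR : forall i, nbrs (srows (addlab (addlab z c) (Some (sk z)))) i = nbrs (srows z) i).
      { intros; simpl. rewrite !nbrs_app; auto. }
      assert (HC2 : Closed (addlab (addlab z c) (Some (sk z))) f2 x).
      { apply (Closed_relabel (addlab z c) f1); auto; [simpl; lia|]. apply Closed_relabel; auto. lia. }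
      set (z2 := addlab (addlab z c) (Some (sk z))) in *.
      assert (Hk2 : sk z2 = S (S (sk z))) by auto.
      assert (HT2 : Tri (f2 x) (f2 (sk z)) (f2 (S (sk z)))) by (rewrite F0, F1, F2; auto).
      assert (HI3 : Inv (addtri z2 x (sk z) (S (sk z))) f2).
      { apply addtri_Inv; auto; try lia; rewrite HR; intros H; apply (in_range _ _ _ _ HI) in H; lia. }
      assert (HL3 : forall m l, In l (snd (nbrs (srows z2) m)) ->
         In l (snd (nbrs (srows (addtri z2 x (sk z) (S (sk z)))) m))).
      { intros m l H. rewrite (addtri_list z2 f2) by (auto; lia). auto. }
      assert (HC3 : Closed (addtri z2 x (sk z) (S (sk z))) f2 x).
      { apply (Closed_mono z2); auto. lia. }
      cbv zeta. fold z2.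
      rewrite (cap_ok_sound _ f2 x) by (auto; simpl; lia).
      apply (IH _ f2); auto. simpl modeOK. repeat split; auto; try (simpl; lia).
      * intros j H1 H2 Hk [v [Hv HTv]].
        destruct (Nat.lt_ge_cases j (sk z)) as [Hj|Hj].
        -- apply HL3. rewrite HR. apply HP; auto. exists v; split; auto. rewrite !F0 in HTv; auto.
        -- rewrite (addtri_list z2 f2) by (auto; lia). left. simpl in H2 |- *. lia.
      * intros v v' Hv Hv' Hov Hov' HTv. rewrite F1. apply Hmax; auto.
        assert (Hd : forall a, out (addtri z2 x (sk z) (S (sk z))) f2 a -> out z f a).
        { intros a Ha i Hi. rewrite <- F0 by auto. apply Ha. simpl. lia. }
        split; auto. exists v'. rewrite F0 in HTv; auto.
    + assert (HC' : Closed z f (S x)).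
      { apply close_sound; auto. intros (u&w&?&?&?&?&?). apply Hno. exists u. eauto 10. }
      intros H.
      assert (H' : match nnbrs z x with 0 => true | S _ =>
        if cap_ok z x x then
          if (if s =? 2 then if x <? 2 then sepbad z else false else false) then true
          else explore main nmax s tmin fuel z (Next (S x))
        else true end = true).
      { destruct (match nnbrs z x with 0 => true | _ => _ end); [auto|discriminate]. }
      clear H. destruct (nnbrs z x) eqn:Hlen.
      { unfold nnbrs in Hlen. destruct (Htri (f x)) as (u&w&Hu&Hw&HT); [apply (i_V _ _ HI); auto|].
        destruct (HC' x (Nat.lt_succ_diag_r x) Hx u w Hu Hw HT) as [j [Hj _]].
        destruct (snd (nbrs (srows z) x)); [destruct Hj|discriminate]. }
      rewrite (cap_ok_sound z f x) in H' by auto.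
      destruct (if s =? 2 then _ else false) eqn:Hs.
      * destruct (Nat.eqb_spec s 2) as [Hs2|]; [|discriminate].
        destruct (x <? 2); [|discriminate].
        destruct (Hsep Hs2) as [Ha Hb].
        rewrite <- !(i_f0 _ _ HI) in Ha, Hb by lia. unfold sepbad in Hs.
        apply orb_true_iff in Hs. destruct Hs as [Hs|Hs].
        -- apply (ro_mem _ _ _ (i_rows _ _ HI)), (ro_E _ _ _ (i_rows _ _ HI)) in Hs.
           destruct Hs as (_&_&Hs). congruence.
        -- apply existsb_exists in Hs. destruct Hs as [a [Ha0 Ha1]].
           apply (ro_mem _ _ _ (i_rows _ _ HI)), (ro_E _ _ _ (i_rows _ _ HI)) in Ha1.
           apply (ro_E _ _ _ (i_rows _ _ HI)) in Ha0.
           rewrite (i_f0 _ _ HI) in Hb by lia.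
           destruct Ha0 as (_&_&E0), Ha1 as (_&Hak&E1). rewrite Hb in E1; [discriminate| |].
           ++ apply (i_V _ _ HI); auto.
           ++ rewrite <- (i_f0 _ _ HI) by lia. auto.
      * revert H'. apply (IH z f); auto. simpl. auto.
Qed.

Hypothesis f0_V : forall i, i < s -> In (f0 i) V.
Hypothesis f0_inj : forall i j, i < s -> j < s -> f0 i = f0 j -> i = j.
Hypothesis f0_max : forall i, i < s -> tdeg (f0 i) <= tdeg (f0 0).

Lemma run_sound : run main nmax s tmin = true -> False.
Proof.
  unfold run. apply (explore_sound _ _ f0).
  - assert (HR : forall i, nbrs (srows (init s)) i = no_nbrs).
    { intros i. simpl. unfold nbrs. generalize (seq 0 s) as l. induction i; intros [|a l]; simpl; auto. }
    split; simpl sk; auto.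
    + split.
      * simpl. rewrite length_map, length_seq; auto.
      * intros i j. rewrite HR. destruct j; simpl; intuition discriminate.
      * intros i j. rewrite HR. simpl; tauto.
      * intros i j. rewrite HR. simpl; tauto.
    + intros i. rewrite HR. constructor.
    + simpl. rewrite length_map, length_seq; auto.
    + intros b Hb. simpl.
      assert (H0 : forall (l : list nat) n, nth n (map (fun _ => 0) l) 0 = 0).
      { induction l; intros [|n]; simpl; auto. }
      rewrite H0. split; [lia|auto].
    + simpl; tauto.
    + intros i j. rewrite HR. simpl. split; [tauto|]. intros (_&t&[]&_).
    + simpl. auto.
  - simpl. split; [lia|]. intros i. lia.
Qed.
End Soundness.

(** * Extending colourings by deleted vertices *)

Lemma colouring_extend V V' v b c : (forall u, In u V -> u = v \/ In u V') -> colouring V' c ->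
  (forall u, In u V' -> E v u = true -> b = true \/ c u = true) ->
  (forall u w, In u V' -> In w V' -> Tri v u w -> b = false \/ c u = false \/ c w = false) ->
  colouring V (fun u => if eqA u v then b else c u).
Proof.
  intros Hin [Hc1 Hc2] He Ht. split.
  - intros x y Hx Hy HE. destruct (eqA x v) as [->|Nx], (eqA y v) as [->|Ny].
    + rewrite E_irr in HE; discriminate.
    + destruct (Hin y Hy); [contradiction|]. auto.
    + destruct (Hin x Hx); [contradiction|]. destruct (He x); auto using E_comm.
    + destruct (Hin x Hx); [contradiction|]. destruct (Hin y Hy); [contradiction|]. auto.
  - assert (Ht' : forall u w, In u V -> In w V -> Tri v u w -> b = false \/
        (if eqA u v then b else c u) = false \/ (if eqA w v then b else c w) = false).
    { intros u w Hu Hw HT. destruct (Hin u Hu) as [->|Hu'].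
      - destruct HT as (HT&_). rewrite E_irr in HT; discriminate.
      - destruct (Hin w Hw) as [->|Hw'].
        + destruct HT as (_&HT&_). rewrite E_irr in HT; discriminate.
        + destruct HT as (E1&E2&E3). pose proof (E_neq _ _ E1). pose proof (E_neq _ _ E2).
          destruct (eqA u v); [congruence|]. destruct (eqA w v); [congruence|].
          apply Ht; auto. repeat split; auto. }
    intros x y z Hx Hy Hz HT.
    destruct (eqA x v) as [->|Nx].
    { apply Ht'; auto. }
    destruct (eqA y v) as [->|Ny].
    { specialize (Ht' x z Hx Hz (Tri_213 _ _ _ HT)). destruct (eqA x v); [contradiction|]. tauto. }
    destruct (eqA z v) as [->|Nz].
    { specialize (Ht' x y Hx Hy (Tri_213 _ _ _ (Tri_132 _ _ _ HT))).
      destruct (eqA x v); [contradiction|]. destruct (eqA y v); [contradiction|]. tauto. }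
    destruct (Hin x Hx); [contradiction|]. destruct (Hin y Hy); [contradiction|].
    destruct (Hin z Hz); [contradiction|]. auto.
Qed.

Definition colourable (V : list A) : Prop := exists c, colouring V c.

(** Serves for deleting a triangle and, as [without v v v], a single vertex. *)
Definition without (p q r : A) (V : list A) : list A :=
  filter (fun u => if in_dec eqA u [p; q; r] then false else true) V.

Lemma without_In p q r V u : In u (without p q r V) <-> In u V /\ u <> p /\ u <> q /\ u <> r.
Proof.
  unfold without. rewrite filter_In. destruct (in_dec eqA u [p; q; r]) as [H|H]; simpl in H; intuition (auto; try discriminate).
Qed.

Lemma without_length p q r V : NoDup [p; q; r] -> incl [p; q; r] V -> length (without p q r V) + 3 <= length V.
Proof.
  intros Hnd Hinc. unfold without.
  rewrite <- (filter_length (fun u => if in_dec eqA u [p; q; r] then false else true) V).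
  apply Nat.add_le_mono_l. apply (NoDup_incl_length Hnd).
  intros u Hu. apply filter_In. split; auto.
  destruct (in_dec eqA u [p; q; r]); auto.
Qed.

(** * A triangle that meets no other triangle *)

Section Isolated.
Variables (V : list A) (p q r : A).
Hypothesis HV : NoDup V.
Hypothesis Hlen : length V <= 17.
Hypothesis Hinc : incl [p; q; r] V.
Hypothesis HT : Tri p q r.
Hypothesis Htri : forall v, In v V -> exists u w, In u V /\ In w V /\ Tri v u w.
Hypothesis Hiso : forall x u w, In x [p; q; r] -> In u V -> In w V -> Tri x u w -> In u [p; q; r].

Let V' := without p q r V.
Let N (x : A) : list A := filter (E x) V'.

Lemma iso_neq : NoDup [p; q; r].
Proof.
  destruct HT as (H1&H2&H3). apply E_neq in H1, H2, H3.
  repeat constructor; simpl; intuition.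
Qed.

Lemma iso_V' u : In u V' <-> In u V /\ ~ In u [p; q; r].
Proof. unfold V'. rewrite without_In. simpl. intuition auto. Qed.

Lemma iso_len : length V' <= 14.
Proof. pose proof (without_length p q r V iso_neq Hinc). unfold V'. lia. Qed.

Lemma N_In x y : In y (N x) <-> In y V' /\ E x y = true.
Proof. apply filter_In. Qed.

(** A triangle through [v] that used a corner would be a second triangle at that corner. *)
Lemma iso_tri v : In v V' -> exists u w, In u V' /\ In w V' /\ Tri v u w.
Proof.
  intros Hv. apply iso_V' in Hv. destruct Hv as [Hv Hn].
  destruct (Htri v Hv) as (u&w&Hu&Hw&Hvuw). exists u, w. rewrite !iso_V'.
  repeat split; auto; try apply Hvuw; intros H; apply Hn.
  - apply (Hiso u v w); auto using Tri_213.
  - apply (Hiso w v u); auto. apply Tri_213, Tri_132; auto.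
Qed.

Lemma tri_edge x y : In x [p; q; r] -> In y [p; q; r] -> x = y \/ E x y = true.
Proof.
  destruct HT as (H1&H2&H3). simpl.
  intros [<-|[<-|[<-|[]]]] [<-|[<-|[<-|[]]]]; auto using E_comm.
Qed.

(* An edge [u v] would close a second triangle at [x] if [x = y], and a 4-cycle otherwise. *)
Lemma N_indep x y u v : In x [p; q; r] -> In y [p; q; r] -> In u (N x) -> In v (N y) -> E u v = false.
Proof.
  intros Hx Hy Hu Hv. apply N_In in Hu, Hv. destruct Hu as [Hu Eu], Hv as [Hv Ev].
  destruct (E u v) eqn:He; auto. exfalso. apply iso_V' in Hu, Hv.
  destruct (tri_edge x y Hx Hy) as [<-|Exy].
  - apply Hu. apply (Hiso x u v); try tauto. repeat split; auto.
  - destruct (E_C4 x u v y); auto using E_comm; subst; tauto.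
Qed.

(** A common outside neighbour of two corners would span a second triangle with them. *)
Lemma N_disj x y u : In x [p; q; r] -> In y [p; q; r] -> x <> y -> In u (N x) -> In u (N y) -> False.
Proof.
  intros Hx Hy Hxy Hu Hv. apply N_In in Hu, Hv. destruct Hu as [Hu Eu], Hv as [Hv Ev].
  apply iso_V' in Hu. destruct (tri_edge x y Hx Hy) as [->|Exy]; [contradiction|].
  apply Hu. apply (Hiso x u y); try tauto.
  - apply Hinc; auto.
  - repeat split; auto using E_comm.
Qed.

(** Otherwise [u], [w], [v], [x] would be a 4-cycle. *)
Lemma N_sep x u v w : In x [p; q; r] -> In u (N x) -> In v (N x) -> u <> v -> In w V' ->
  E u w = true -> E v w = false.
Proof.
  intros Hx Hu Hv Huv Hw Eu. apply N_In in Hu, Hv.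
  destruct (E v w) eqn:Ev; auto. exfalso.
  destruct (E_C4 u w v x) as [H|H]; auto using E_comm.
  - apply E_comm; tauto.
  - tauto.
  - subst. apply iso_V' in Hw. tauto.
Qed.

Lemma all_N_NoDup : NoDup (N p ++ N q ++ N r).
Proof.
  assert (HN : forall x, NoDup (N x)) by (intros; repeat apply NoDup_filter; auto).
  pose proof iso_neq as Hne. inversion Hne as [|? ? Hp Hne']; subst. inversion Hne' as [|? ? Hq _]; subst.
  simpl in Hp, Hq.
  repeat apply NoDup_app; auto.
  - intros a Ha Hb. apply (N_disj q r a); simpl; auto.
  - intros a Ha Hb. apply in_app_iff in Hb. destruct Hb; [apply (N_disj p q a)|apply (N_disj p r a)]; simpl; auto.
Qed.

Lemma all_N_In u : In u (N p ++ N q ++ N r) -> exists x, In x [p; q; r] /\ In u (N x).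
Proof.
  rewrite !in_app_iff. intros [H|[H|H]]; [exists p|exists q|exists r]; simpl; auto.
Qed.

Lemma all_N_V' : incl (N p ++ N q ++ N r) V'.
Proof. intros u Hu. apply all_N_In in Hu. destruct Hu as [x [_ Hu]]. apply N_In in Hu; tauto. Qed.

Lemma many_independent m : m <= length (N p) + length (N q) + length (N r) ->
  exists W, NoDup W /\ incl W V' /\ m <= length W /\
  forall x y, In x W -> In y W -> E x y = false.
Proof.
  intros Hm. exists (N p ++ N q ++ N r). repeat split.
  - apply all_N_NoDup.
  - apply all_N_V'.
  - rewrite !length_app. lia.
  - intros u v Hu Hv. apply all_N_In in Hu, Hv. destruct Hu as [x [Hx Hu]], Hv as [y [Hy Hv]].
    eapply (N_indep x y); eauto.
Qed.

Lemma force1 x y : In x [p; q; r] -> N x = [y] ->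
  3 <= length (N p) + length (N q) + length (N r) ->
  exists c, colouring V' c /\ forall u, In u (N x) -> c u = true.
Proof.
  intros Hx HN Hm. apply NNPP. intros Hno.
  assert (Hy : In y (N x)) by (rewrite HN; simpl; auto).
  eapply (run_sound V' false 14 1 3 (fun _ => y)); try discriminate.
  - repeat apply NoDup_filter; auto.
  - apply iso_len.
  - intros c Hc. exists 0. split; auto. destruct (c y) eqn:Hcy; auto. exfalso. apply Hno.
    exists c; split; auto. rewrite HN. intros u [<-|[]]; auto.
  - apply iso_tri.
  - apply many_independent; auto.
  - intros i Hi. apply N_In in Hy; tauto.
  - intros i j Hi Hj _. lia.
  - auto.
  - apply run_forced1.
Qed.

Lemma force2 x y y' : In x [p; q; r] -> N x = [y; y'] \/ N x = [y'; y] ->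
  tdeg V' y' <= tdeg V' y ->
  6 <= length (N p) + length (N q) + length (N r) ->
  exists c, colouring V' c /\ forall u, In u (N x) -> c u = true.
Proof.
  intros Hx HN Hg Hm. apply NNPP. intros Hno.
  assert (Hy : In y (N x)) by (destruct HN as [-> | ->]; simpl; auto).
  assert (Hy' : In y' (N x)) by (destruct HN as [-> | ->]; simpl; auto).
  assert (Hall : forall u, In u (N x) -> u = y \/ u = y').
  { intros u. destruct HN as [-> | ->]; simpl; intuition. }
  assert (Hne : y <> y').
  { assert (Hnd : NoDup (N x)) by (repeat apply NoDup_filter; auto).
    destruct HN as [H|H]; rewrite H in Hnd; inversion Hnd as [|? ? Hn _]; subst; simpl in Hn; intros ->; tauto. }
  eapply (run_sound V' false 14 2 6 (fun i => match i with 0 => y | _ => y' end)); try discriminate.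
  - repeat apply NoDup_filter; auto.
  - apply iso_len.
  - intros c Hc. destruct (c y) eqn:Hcy.
    + exists 1. split; auto. destruct (c y') eqn:Hcy'; auto. exfalso. apply Hno.
      exists c; split; auto. intros u Hu. destruct (Hall u Hu); subst; auto.
    + exists 0. auto.
  - apply iso_tri.
  - intros _. split.
    + eapply N_indep; eauto.
    + intros w Hw. eapply N_sep; eauto.
  - apply many_independent; auto.
  - intros i Hi. apply N_In in Hy, Hy'. destruct i; tauto.
  - intros i j Hi Hj. destruct i as [|[|i]], j as [|[|j]]; auto; try lia; intros; subst; tauto.
  - intros [|i] Hi; auto.
  - apply run_forced2.
Qed.

(** Three neighbours of [p] have triangles whose six further corners are distinct by [N_sep] and
    avoid all neighbourhoods by [N_indep]. With at least nine neighbours this makes 15 vertices, one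
    more than [iso_len] permits. *)
Lemma not_all_big : 3 <= length (N p) -> 3 <= length (N q) -> 3 <= length (N r) -> False.
Proof.
  intros H1 H2 H3.
  assert (HNd : NoDup (N p)) by (repeat apply NoDup_filter; auto).
  destruct (N p) as [|y1 [|y2 [|y3 l]]] eqn:HN; simpl in H1; try lia.
  set (W := N p ++ N q ++ N r).
  assert (Hex : forall y, In y (N p) -> exists u w, In u V' /\ In w V' /\ Tri y u w).
  { intros y Hy. apply iso_tri. apply N_In in Hy; tauto. }
  assert (I1 : In y1 (N p)) by (rewrite HN; simpl; auto).
  assert (I2 : In y2 (N p)) by (rewrite HN; simpl; auto).
  assert (I3 : In y3 (N p)) by (rewrite HN; simpl; auto).
  assert (D : y1 <> y2 /\ y1 <> y3 /\ y2 <> y3).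
  { inversion HNd as [|? ? Ha Hb]; subst. inversion Hb as [|? ? Hc _]; subst. simpl in Ha, Hc. intuition. }
  destruct D as (D12&D13&D23).
  destruct (Hex y1 I1) as (u1&w1&U1&W1&T1), (Hex y2 I2) as (u2&w2&U2&W2&T2), (Hex y3 I3) as (u3&w3&U3&W3&T3).
  assert (Hp : In p [p; q; r]) by (simpl; auto).
  assert (HW : forall y u, In y (N p) -> E y u = true -> ~ In u W).
  { intros y u Hy He Hu. apply all_N_In in Hu. destruct Hu as [x [Hx Hu]].
    rewrite (N_indep p x y u) in He; auto; discriminate. }
  assert (HS : forall y y' u u', In y (N p) -> In y' (N p) -> y <> y' -> In u V' -> E y u = true -> E y' u' = true -> u <> u').
  { intros y y' u u' Hy Hy' Hne Hu He He' <-. rewrite (N_sep p y y' u) in He'; auto; discriminate. }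
  assert (Hnd : NoDup ([u1; w1; u2; w2; u3; w3] ++ W)).
  { apply NoDup_app; [|apply all_N_NoDup|].
    - destruct T1 as (A1&B1&C1), T2 as (A2&B2&C2), T3 as (A3&B3&C3).
      apply E_neq in C1, C2, C3.
      pose proof (HS y1 y2 u1 u2 I1 I2 D12 U1 A1 A2). pose proof (HS y1 y2 u1 w2 I1 I2 D12 U1 A1 B2).
      pose proof (HS y1 y2 w1 u2 I1 I2 D12 W1 B1 A2). pose proof (HS y1 y2 w1 w2 I1 I2 D12 W1 B1 B2).
      pose proof (HS y1 y3 u1 u3 I1 I3 D13 U1 A1 A3). pose proof (HS y1 y3 u1 w3 I1 I3 D13 U1 A1 B3).
      pose proof (HS y1 y3 w1 u3 I1 I3 D13 W1 B1 A3). pose proof (HS y1 y3 w1 w3 I1 I3 D13 W1 B1 B3).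
      pose proof (HS y2 y3 u2 u3 I2 I3 D23 U2 A2 A3). pose proof (HS y2 y3 u2 w3 I2 I3 D23 U2 A2 B3).
      pose proof (HS y2 y3 w2 u3 I2 I3 D23 W2 B2 A3). pose proof (HS y2 y3 w2 w3 I2 I3 D23 W2 B2 B3).
      repeat constructor; simpl; intuition congruence.
    - destruct T1 as (A1&B1&_), T2 as (A2&B2&_), T3 as (A3&B3&_).
      simpl. intros a [<-|[<-|[<-|[<-|[<-|[<-|[]]]]]]]; eauto. }
  assert (Hincl : incl ([u1; w1; u2; w2; u3; w3] ++ W) V').
  { intros a Ha. apply in_app_iff in Ha. destruct Ha as [Ha|Ha]; [|apply all_N_V'; auto].
    simpl in Ha. destruct Ha as [<-|[<-|[<-|[<-|[<-|[<-|[]]]]]]]; auto. }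
  pose proof (NoDup_incl_length Hnd Hincl) as Hl. pose proof iso_len.
  unfold W in Hl. rewrite !length_app, HN in Hl. simpl in Hl. lia.
Qed.

Lemma force_some : colourable V' ->
  exists x c, In x [p; q; r] /\ colouring V' c /\ forall u, In u (N x) -> c u = true.
Proof.
  intros [c0 Hc0].
  assert (H0 : forall x, In x [p; q; r] -> length (N x) = 0 ->
    exists c, colouring V' c /\ forall u, In u (N x) -> c u = true).
  { intros x Hx H. exists c0. split; auto. destruct (N x); [simpl; tauto|discriminate]. }
  assert (Hs1 : forall x, In x [p; q; r] -> length (N x) = 1 ->
    3 <= length (N p) + length (N q) + length (N r) ->
    exists c, colouring V' c /\ forall u, In u (N x) -> c u = true).
  { intros x Hx H Hm. destruct (N x) as [|y [|? ?]] eqn:HN; try discriminate.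
    rewrite <- HN. eapply force1; eauto. }
  assert (Hs2 : forall x, In x [p; q; r] -> length (N x) = 2 ->
    6 <= length (N p) + length (N q) + length (N r) ->
    exists c, colouring V' c /\ forall u, In u (N x) -> c u = true).
  { intros x Hx H Hm. destruct (N x) as [|y [|y' [|? ?]]] eqn:HN; try discriminate.
    rewrite <- HN. destruct (Nat.le_ge_cases (tdeg V' y') (tdeg V' y)).
    - eapply force2 with (y := y); eauto.
    - eapply force2 with (y := y'); eauto. }
  assert (Hpp : In p [p; q; r]) by (simpl; auto).
  assert (Hqq : In q [p; q; r]) by (simpl; auto).
  assert (Hrr : In r [p; q; r]) by (simpl; auto).
  pose proof not_all_big as Hbig.
  assert (Hgoal : exists x, In x [p; q; r] /\ exists c, colouring V' c /\ forall u, In u (N x) -> c u = true).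
  (* The order matters: once size 0 is excluded everywhere the total is at least 3, and once size 1
     is excluded it is at least 6. *)
  { destruct (Nat.eq_dec (length (N p)) 0); [exists p; auto|].
    destruct (Nat.eq_dec (length (N q)) 0); [exists q; auto|].
    destruct (Nat.eq_dec (length (N r)) 0); [exists r; auto|].
    destruct (Nat.eq_dec (length (N p)) 1); [exists p; split; auto; apply Hs1; auto; lia|].
    destruct (Nat.eq_dec (length (N q)) 1); [exists q; split; auto; apply Hs1; auto; lia|].
    destruct (Nat.eq_dec (length (N r)) 1); [exists r; split; auto; apply Hs1; auto; lia|].
    destruct (Nat.eq_dec (length (N p)) 2); [exists p; split; auto; apply Hs2; auto; lia|].
    destruct (Nat.eq_dec (length (N q)) 2); [exists q; split; auto; apply Hs2; auto; lia|].
    destruct (Nat.eq_dec (length (N r)) 2); [exists r; split; auto; apply Hs2; auto; lia|].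
    exfalso; apply Hbig; lia. }
  destruct Hgoal as (x&Hx&c&Hc1&Hc2). eauto.
Qed.

(** The corner [x] takes 0, and all its neighbours have 1. The corners [y] and [z] take 1, which
    harms no edge, and their only triangle contains [x]. *)
Lemma extend_iso x y z c : In x [p; q; r] -> In y [p; q; r] -> In z [p; q; r] ->
  (forall u, In u [p; q; r] -> u = x \/ u = y \/ u = z) -> x <> y -> x <> z -> y <> z ->
  colouring V' c -> (forall u, In u (N x) -> c u = true) -> colourable V.
Proof.
  intros Hx Hy Hz Hall Nxy Nxz Nyz Hc HN.
  assert (Hout : forall a u w, In a [p; q; r] -> In u V' -> In w V -> Tri a u w -> False).
  { intros a u w Ha Hu Hw Ht. apply iso_V' in Hu. apply Hu. apply (Hiso a u w); tauto. }
  assert (HV'V : forall u, In u V' -> In u V) by (intros u Hu; apply iso_V' in Hu; tauto).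
  pose proof (colouring_extend (x :: V') V' x false c) as K1.
  set (c1 := fun u => if eqA u x then false else c u) in K1.
  assert (C1 : colouring (x :: V') c1).
  { apply K1; auto.
    - intros u [<-|Hu]; auto.
    - intros u Hu He. right. apply HN, N_In. auto. }
  pose proof (colouring_extend (y :: x :: V') (x :: V') y true c1) as K2.
  set (c2 := fun u => if eqA u y then true else c1 u) in K2.
  assert (C2 : colouring (y :: x :: V') c2).
  { apply K2; auto.
    - intros u [<-|Hu]; auto.
    - intros u w Hu Hw Ht. right. destruct Hu as [<-|Hu].
      + left. unfold c1. destruct (eqA x x); congruence.
      + exfalso. apply (Hout y u w); auto. destruct Hw as [<-|Hw]; auto. }
  eexists. apply (colouring_extend V (y :: x :: V') z true c2); auto.
  - intros u Hu. destruct (in_dec eqA u [p; q; r]) as [Hi|Hi].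
    + destruct (Hall u Hi) as [->|[->| ->]]; simpl; auto.
    + right. simpl. right. right. apply iso_V'. auto.
  - intros u w Hu Hw Ht. right.
    assert (Hxc : c2 x = false).
    { unfold c2, c1. destruct (eqA x y); [contradiction|]. destruct (eqA x x); congruence. }
    assert (HuV : In u V) by (destruct Hu as [<-|[<-|Hu]]; auto).
    assert (HwV : In w V) by (destruct Hw as [<-|[<-|Hw]]; auto).
    destruct Hu as [<-|[<-|Hu]]; auto.
    + destruct Hw as [<-|[<-|Hw]]; auto.
      * destruct Ht as (_&_&Ht). rewrite E_irr in Ht; discriminate.
      * exfalso. apply (Hout z w y); auto using Tri_132.
    + exfalso. apply (Hout z u w); auto.
Qed.

Lemma isolated_colourable : colourable V' -> colourable V.
Proof.
  intros H. destruct (force_some H) as (x&c&Hx&Hc&HN).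
  destruct HT as (E1&E2&E3). apply E_neq in E1, E2, E3.
  destruct Hx as [<-|[<-|[<-|[]]]].
  - apply (extend_iso p q r c); simpl; auto; intuition.
  - apply (extend_iso q p r c); simpl; auto; intuition.
  - apply (extend_iso r p q c); simpl; auto; intuition.
Qed.
End Isolated.

(** The induction makes every proper deletion colourable, so a counterexample is vertex-minimal, and
    the 14 vertices left by an isolated triangle are covered as well. *)
Theorem graph_colourable n : forall V, NoDup V -> length V <= n -> n <= 17 -> colourable V.
Proof.
  induction n as [|n IH]; intros V HV Hl Hn.
  { exists (fun _ => true). destruct V; [|simpl in Hl; lia]. split; simpl; tauto. }
  apply NNPP. intros Hnc.
  assert (Hrem : forall v, In v V -> exists c, colouring (without v v v V) c).
  { intros v Hv. apply IH; try lia.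
    - apply NoDup_filter; auto.
    - assert (length (without v v v V) < length V); [|lia].
      unfold without. rewrite <- (filter_length (fun u => if in_dec eqA u [v; v; v] then false else true) V).
      assert (Hin : In v (filter (fun x => negb (if in_dec eqA x [v; v; v] then false else true)) V)).
      { apply filter_In. split; auto. destruct (in_dec eqA v [v; v; v]) as [|Hn']; auto. simpl in Hn'. tauto. }
      destruct (filter (fun x => negb _) V); [destruct Hin|simpl; lia]. }
  assert (Hsplit : forall v u, In u V -> u = v \/ In u (without v v v V)).
  { intros v u Hu. destruct (eqA u v); auto. right. apply without_In. auto. }
  assert (HVV : forall v u, In u (without v v v V) -> In u V) by (intros v u Hu; apply without_In in Hu; tauto).
  assert (Htri : forall v, In v V -> exists u w, In u V /\ In w V /\ Tri v u w).
  { intros v Hv. apply NNPP. intros Hno. apply Hnc. destruct (Hrem v Hv) as [c Hc].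
    eexists. apply (colouring_extend V (without v v v V) v true c); auto.
    (* A vertex in no triangle can always take colour 1. *)
    intros u w Hu Hw HT. exfalso; apply Hno. exists u, w. eauto. }
  assert (Hdeg : forall v a b, In v V -> exists u, In u V /\ E v u = true /\ u <> a /\ u <> b).
  { intros v a b Hv. apply NNPP. intros Hno.
    assert (Hab : forall u, In u V -> E v u = true -> u = a \/ u = b).
    { intros u Hu He. destruct (eqA u a); auto. destruct (eqA u b); auto. exfalso; eauto 10. }
    destruct (Htri v Hv) as (x&y&Hx&Hy&HT).
    assert (Hxy : forall u, In u V -> E v u = true -> u = x \/ u = y).
    { destruct HT as (E1&E2&E3). apply E_neq in E3.
      intros u Hu He. destruct (Hab x Hx E1), (Hab y Hy E2), (Hab u Hu He); subst; auto; congruence. }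
    apply Hnc. destruct (Hrem v Hv) as [c Hc].
    (* A vertex whose only neighbours are [x] and [y] takes 0 if both have 1; otherwise 1 is safe,
       since its triangle already contains a 0. *)
    eexists. apply (colouring_extend V (without v v v V) v (negb (c x && c y)) c); auto.
    - intros u Hu He. destruct (c x) eqn:Cx; destruct (c y) eqn:Cy; simpl; auto.
      right. destruct (Hxy u) as [->| ->]; eauto.
    - intros u w Hu Hw (E1&E2&E3). apply E_neq in E3.
      destruct (c x) eqn:Cx; destruct (c y) eqn:Cy; simpl; auto; right;
      destruct (Hxy u) as [->| ->]; eauto; destruct (Hxy w) as [->| ->]; eauto; congruence. }
  destruct V as [|v0 V0] eqn:HV0.
  { apply Hnc. exists (fun _ => true). split; simpl; tauto. }
  rewrite <- HV0 in *.
  apply (run_sound V true 17 0 0 (fun _ => v0)).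
  - auto.
  - lia.
  - intros c Hc. exfalso. apply Hnc. exists c; auto.
  - auto.
  - auto.
  - intros _ p q r Hp Hq Hr HT. apply NNPP. intros Hno.
    assert (Hinc : incl [p; q; r] V) by (intros u [<-|[<-|[<-|[]]]]; auto).
    assert (Hne : NoDup [p; q; r]).
    { destruct HT as (E1&E2&E3). apply E_neq in E1, E2, E3. repeat constructor; simpl; intuition. }
    apply Hnc. apply (isolated_colourable V p q r); auto; try lia.
    + intros x u w Hx Hu Hw Ht. apply NNPP. intros Hnin. apply Hno. exists x, u, w.
      simpl in Hx, Hnin. intuition.
    + apply IH; try lia; [apply NoDup_filter; auto|].
      pose proof (without_length p q r V Hne Hinc). lia.
  - intros Hs; discriminate.
  - exists []. repeat split; [constructor|intros ? []|simpl; lia|intros ? ? []].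
  - intros i Hi; lia.
  - intros i j Hi; lia.
  - intros i Hi; lia.
  - apply run_main.
Qed.
End Graph.

(** * Geometry *)

From Stdlib Require Import Nsatz.
Open Scope R_scope.

Definition cross (u v : vec3) : vec3 :=
  let '(x1, y1, z1) := u in let '(x2, y2, z2) := v in
  (y1 * z2 - z1 * y2, z1 * x2 - x1 * z2, x1 * y2 - y1 * x2).

Lemma in_H2_unit u : in_H2 u -> dot u u = 1.
Proof. destruct u as [[x y] z]. intros [H _]. exact H. Qed.

Lemma dot_comm u v : dot u v = dot v u.
Proof. destruct u as [[? ?] ?], v as [[? ?] ?]. simpl. ring. Qed.

(** Equality in Cauchy-Schwarz: [S] says that [u] is [k] times [v]. As [k * k = 1], the positive
    third coordinates force [k = 1]. *)
Lemma in_H2_dot_sq u v : in_H2 u -> in_H2 v -> dot u v * dot u v = 1 -> u = v.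
Proof.
  destruct u as [[x y] z], v as [[a b] c]. simpl. intros [H1 Hz] [H2 Hc] H.
  remember (x * a + y * b + z * c) as k eqn:Hk.
  assert (S : (x - k * a) * (x - k * a) + (y - k * b) * (y - k * b) + (z - k * c) * (z - k * c) = 0).
  { transitivity ((x * x + y * y + z * z) - 2 * k * (x * a + y * b + z * c)
      + k * k * (a * a + b * b + c * c)); [ring|]. rewrite H1, H2, <- Hk. lra. }
  pose proof (Rle_0_sqr (x - k * a)). pose proof (Rle_0_sqr (y - k * b)). pose proof (Rle_0_sqr (z - k * c)).
  unfold Rsqr in *.
  assert (Ex : x - k * a = 0) by (apply Rsqr_0_uniq; unfold Rsqr; lra).
  assert (Ey : y - k * b = 0) by (apply Rsqr_0_uniq; unfold Rsqr; lra).
  assert (Ez : z - k * c = 0) by (apply Rsqr_0_uniq; unfold Rsqr; lra).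
  clear Hk. assert (Hk : k = 1) by nra. subst k. f_equal; [f_equal|]; lra.
Qed.

Lemma sq_dot_cross u v : dot (cross u v) (cross u v) = dot u u * dot v v - dot u v * dot u v.
Proof. destruct u as [[? ?] ?], v as [[? ?] ?]. simpl. ring. Qed.

(** Vectors parallel to a common nonzero vector are parallel. The product form keeps [m = 0] as the
    alternative, which for [m] equal to the cross product of [b] and [d] becomes [b = d]. *)
Lemma parallel_both m a c : cross m a = (0, 0, 0) -> cross m c = (0, 0, 0) ->
  dot m m * dot (cross a c) (cross a c) = 0.
Proof.
  destruct m as [[m1 m2] m3], a as [[a1 a2] a3], c as [[c1 c2] c3]. simpl.
  intros H H'. injection H as A1 A2 A3. injection H' as C1 C2 C3.
  nsatz.
Qed.

(* For b, d both orthogonal to a and c, the vector b x d is parallel to a and to c. *)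
Lemma orthogonal_C4 a b c d : in_H2 a -> in_H2 b -> in_H2 c -> in_H2 d ->
  orthogonal a b -> orthogonal b c -> orthogonal c d -> orthogonal d a -> a = c \/ b = d.
Proof.
  intros Ha Hb Hc Hd. unfold orthogonal. intros Hab Hbc Hcd Hda.
  assert (X : forall w, dot b w = 0 -> dot d w = 0 -> cross (cross b d) w = (0, 0, 0)).
  { intros w H1 H2.
    transitivity (let '(b1, b2, b3) := b in let '(d1, d2, d3) := d in
      (d1 * dot b w - b1 * dot d w, d2 * dot b w - b2 * dot d w, d3 * dot b w - b3 * dot d w)).
    - destruct b as [[? ?] ?], d as [[? ?] ?], w as [[? ?] ?]. simpl. f_equal; [f_equal|]; ring.
    - rewrite H1, H2. destruct b as [[? ?] ?], d as [[? ?] ?]. f_equal; [f_equal|]; ring. }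
  rewrite dot_comm in Hab, Hcd.
  pose proof (parallel_both _ _ _ (X a Hab Hda) (X c Hbc Hcd)) as K.
  rewrite !sq_dot_cross, !in_H2_unit in K by auto.
  apply Rmult_integral in K. destruct K as [K|K].
  - right. apply in_H2_dot_sq; auto; lra.
  - left. apply in_H2_dot_sq; auto; lra.
Qed.

(** * Orthonormal coordinates and the unrealizable 10-vertex graph *)

Lemma frame_dot e0 e1 u v : dot e0 e0 = 1 -> dot e1 e1 = 1 -> dot e0 e1 = 0 ->
  dot u v = dot u (cross e1 e0) * dot v (cross e1 e0) + dot u e1 * dot v e1 + dot u e0 * dot v e0.
Proof.
  intros H0 H1 H01.
  (* A product of two triple products is a Gram determinant, here expanded along its first row. *)
  assert (G : dot u (cross e1 e0) * dot v (cross e1 e0) =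
    dot e0 e0 * (dot e1 e1 * dot u v - dot e1 v * dot e1 u)
    - dot e0 e1 * (dot e0 e1 * dot u v - dot e1 v * dot e0 u)
    + dot e0 v * (dot e0 e1 * dot e1 u - dot e1 e1 * dot e0 u)).
  { destruct e0 as [[? ?] ?], e1 as [[? ?] ?], u as [[? ?] ?], v as [[? ?] ?]. simpl. ring. }
  rewrite G, H0, H1, H01, (dot_comm u e1), (dot_comm v e1), (dot_comm u e0), (dot_comm v e0). ring.
Qed.

Lemma sq_sum_zero x y : x = 0 -> y = 0 -> x * x + y * y = 1 -> False.
Proof. intros -> ->. lra. Qed.

Lemma perp_plane x y c s : c * c + s * s = 1 -> c * x + s * y = 0 ->
  exists t, x = - t * s /\ y = t * c.
Proof.
  intros H H'. exists (c * y - s * x). split.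
  - replace x with ((c * c + s * s) * x) at 1 by (rewrite H; ring).
    replace (- (c * y - s * x) * s) with (s * s * x - c * (s * y)) by ring.
    replace (s * y) with (- (c * x)) by lra. ring.
  - replace y with ((c * c + s * s) * y) at 1 by (rewrite H; ring).
    replace ((c * y - s * x) * c) with (c * c * y - s * (c * x)) by ring.
    replace (c * x) with (- (s * y)) by lra. ring.
Qed.

(** In a frame with second and third axes [v1] and [v0], the vectors [v2], [v3] are [(c, s, 0)],
    [(m, n, 0)], the vectors [v4], [v5] are [(c', 0, s')], [(m', 0, n')], and the four triples are
    [v6] to [v9]. If [s] or [s'] vanishes, [v3] is parallel to [v1] or [v5] to [v0]. Otherwise [v7]
    and [v8] determine the directions of [v6] and [v9], which cannot be orthogonal. *)
Lemma unembeddable_coordinates c s m n c' s' m' n' x y z p q r l h j u v w :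
  c * c + s * s = 1 -> m * m + n * n = 1 -> c' * c' + s' * s' = 1 -> m' * m' + n' * n' = 1 ->
  x * x + y * y + z * z = 1 -> p * p + q * q + r * r = 1 ->
  l * l + h * h + j * j = 1 -> u * u + v * v + w * w = 1 ->
  c * m + s * n = 0 -> c' * m' + s' * n' = 0 -> c * x + s * y = 0 -> c * p + s * q = 0 ->
  x * p + y * q + z * r = 0 -> c' * l + s' * j = 0 -> c' * u + s' * w = 0 ->
  l * u + h * v + j * w = 0 -> m * l + n * h = 0 -> m' * p + n' * r = 0 ->
  x * u + y * v + z * w = 0 -> n * n = 1 \/ n' * n' = 1.
Proof.
  intros U2 U3 U4 U5 U6 U7 U8 U9 O23 O45 O26 O27 O67 O48 O49 O89 O38 O57 O69.
  destruct (perp_plane _ _ _ _ U2 O23) as [e [-> ->]].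
  destruct (perp_plane _ _ _ _ U4 O45) as [e' [-> ->]].
  destruct (perp_plane _ _ _ _ U2 O26) as [al [-> ->]].
  destruct (perp_plane _ _ _ _ U2 O27) as [be [-> ->]].
  destruct (perp_plane _ _ _ _ U4 O48) as [de [-> ->]].
  destruct (perp_plane _ _ _ _ U4 O49) as [ga [-> ->]].
  assert (Ue : e * e = 1) by (rewrite <- U3, <- (Rmult_1_r (e * e)), <- U2; ring).
  assert (Ue' : e' * e' = 1) by (rewrite <- U5, <- (Rmult_1_r (e' * e')), <- U4; ring).
  assert (V6 : al * al + z * z = 1) by (rewrite <- U6, <- (Rmult_1_r (al * al)), <- U2; ring).
  assert (V7 : be * be + r * r = 1) by (rewrite <- U7, <- (Rmult_1_r (be * be)), <- U2; ring).
  assert (V8 : de * de + h * h = 1) by (rewrite <- U8, <- (Rmult_1_r (de * de)), <- U4; ring).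
  assert (V9 : ga * ga + v * v = 1) by (rewrite <- U9, <- (Rmult_1_r (ga * ga)), <- U4; ring).
  destruct (Req_EM_T s 0) as [->|Hs].
  { left. replace (e * c * (e * c)) with (e * e * (c * c)) by ring. rewrite Ue. lra. }
  destruct (Req_EM_T s' 0) as [->|Hs'].
  { right. replace (e' * c' * (e' * c')) with (e' * e' * (c' * c')) by ring. rewrite Ue'. lra. }
  exfalso.
  assert (Hk : s * s' <> 0) by (apply Rmult_integral_contrapositive; auto).
  assert (He : e <> 0) by (intros ->; lra). assert (He' : e' <> 0) by (intros ->; lra).
  assert (P7 : s * s' * be + c' * r = 0).
  { apply (Rmult_eq_reg_l e'); auto. rewrite Rmult_0_r, <- O57. ring. }
  assert (P8 : s * s' * de + c * h = 0).
  { apply (Rmult_eq_reg_l e); auto. rewrite Rmult_0_r, <- O38. ring. }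
  assert (Q7 : al * be + z * r = 0).
  { rewrite <- O67. transitivity (al * be * (c * c + s * s) + z * r); [rewrite U2|]; ring. }
  assert (Q8 : ga * de + v * h = 0).
  { rewrite <- O89. transitivity (ga * de * (c' * c' + s' * s') + v * h); [rewrite U4|]; ring. }
  assert (Hr : r <> 0).
  { intros ->. apply (sq_sum_zero be 0); auto. apply (Rmult_eq_reg_l (s * s')); auto. lra. }
  assert (Hh : h <> 0).
  { intros ->. apply (sq_sum_zero de 0); auto. apply (Rmult_eq_reg_l (s * s')); auto. lra. }
  assert (Ez : al * c' = s * s' * z).
  { apply (Rmult_eq_reg_r r); auto.
    transitivity (al * (s * s' * be + c' * r) - s * s' * (al * be + z * r) + s * s' * z * r); [ring|].
    rewrite P7, Q7. ring. }
  assert (Ev : ga * c = s * s' * v).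
  { apply (Rmult_eq_reg_r h); auto.
    transitivity (ga * (s * s' * de + c * h) - s * s' * (ga * de + v * h) + s * s' * v * h); [ring|].
    rewrite P8, Q8. ring. }
  (* Multiplied by [s * s'], each of the three terms of [O69] becomes [al * ga] times a square, so
     they cannot cancel. *)
  assert (F : al * ga * ((s * s') * (s * s') + c * c + c' * c') = 0).
  { transitivity (s * s' * (al * ga * (s * s') + al * c * v + z * (ga * c'))).
    - transitivity (s * s' * s * s' * al * ga + al * c * (ga * c) + (al * c') * (ga * c')); [ring|].
      rewrite Ev, Ez. ring.
    - replace (al * ga * (s * s') + al * c * v + z * (ga * c')) with 0; [ring|]. rewrite <- O69. ring. }
  assert (Hpos : 0 < (s * s') * (s * s') + c * c + c' * c').
  { assert (0 < (s * s') * (s * s')) by (apply Rsqr_pos_lt; auto).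
    pose proof (Rle_0_sqr c). pose proof (Rle_0_sqr c'). unfold Rsqr in *. lra. }
  apply Rmult_integral in F. destruct F as [F|F]; [|lra].
  apply Rmult_integral in F. destruct F as [-> | ->].
  - apply (sq_sum_zero 0 z); auto. apply (Rmult_eq_reg_l (s * s')); auto. lra.
  - apply (sq_sum_zero 0 v); auto. apply (Rmult_eq_reg_l (s * s')); auto. lra.
Qed.

Lemma unembeddable v0 v1 v2 v3 v4 v5 v6 v7 v8 v9 :
  in_H2 v0 -> in_H2 v1 -> in_H2 v2 -> in_H2 v3 -> in_H2 v4 ->
  in_H2 v5 -> in_H2 v6 -> in_H2 v7 -> in_H2 v8 -> in_H2 v9 ->
  dot v0 v1 = 0 -> dot v0 v2 = 0 -> dot v0 v3 = 0 -> dot v2 v3 = 0 ->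
  dot v1 v4 = 0 -> dot v1 v5 = 0 -> dot v4 v5 = 0 ->
  dot v2 v6 = 0 -> dot v2 v7 = 0 -> dot v6 v7 = 0 ->
  dot v4 v8 = 0 -> dot v4 v9 = 0 -> dot v8 v9 = 0 ->
  dot v3 v8 = 0 -> dot v5 v7 = 0 -> dot v6 v9 = 0 -> v3 = v1 \/ v5 = v0.
Proof.
  intros U0 U1 U2 U3 U4 U5 U6 U7 U8 U9 O01 O02 O03 O23 O14 O15 O45 O26 O27 O67 O48 O49 O89 O38 O57 O69.
  pose proof (frame_dot v0 v1) as F. set (X := fun u => dot u (cross v1 v0)).
  assert (F' : forall u v, dot u v = X u * X v + dot u v1 * dot v v1 + dot u v0 * dot v v0).
  { intros u v. apply F; auto using in_H2_unit. }
  clear F. clearbody X.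
  assert (S : dot v3 v1 * dot v3 v1 = 1 \/ dot v5 v0 * dot v5 v0 = 1).
  { rewrite dot_comm in O02, O03, O14, O15.
    apply (unembeddable_coordinates (X v2) (dot v2 v1) (X v3) (dot v3 v1)
      (X v4) (dot v4 v0) (X v5) (dot v5 v0)
      (X v6) (dot v6 v1) (dot v6 v0) (X v7) (dot v7 v1) (dot v7 v0)
      (X v8) (dot v8 v1) (dot v8 v0) (X v9) (dot v9 v1) (dot v9 v0));
    [ rewrite <- (in_H2_unit v2 U2) | rewrite <- (in_H2_unit v3 U3)
    | rewrite <- (in_H2_unit v4 U4) | rewrite <- (in_H2_unit v5 U5)
    | rewrite <- (in_H2_unit v6 U6) | rewrite <- (in_H2_unit v7 U7)
    | rewrite <- (in_H2_unit v8 U8) | rewrite <- (in_H2_unit v9 U9)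
    | rewrite <- O23 | rewrite <- O45 | rewrite <- O26 | rewrite <- O27 | rewrite <- O67
    | rewrite <- O48 | rewrite <- O49 | rewrite <- O89 | rewrite <- O38 | rewrite <- O57 | rewrite <- O69 ];
    match goal with |- _ = dot ?a ?b => rewrite (F' a b) end;
    rewrite ?O02, ?O03, ?O14, ?O15; ring. }
  destruct S as [S|S]; [left|right]; apply in_H2_dot_sq; auto.
Qed.

(** * The orthogonality graph *)

Lemma vec3_eq_dec (u v : vec3) : {u = v} + {u <> v}.
Proof. decide equality; [apply Req_EM_T|decide equality; apply Req_EM_T]. Defined.

Lemma in_H2_dec u : {in_H2 u} + {~ in_H2 u}.
Proof.
  destruct u as [[x y] z]. unfold in_H2.
  destruct (Req_EM_T (x * x + y * y + z * z) 1); [|right; tauto].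
  destruct (Rlt_dec 0 z); [left; auto|right; tauto].
Defined.

(** Membership in the half-sphere is built in because the graph hypotheses range over the whole
    type: the zero vector would be a loop, and proportional vectors would give 4-cycles. *)
Definition adj (u v : vec3) : bool :=
  if Req_EM_T (dot u v) 0 then if in_H2_dec u then if in_H2_dec v then true else false else false else false.

Lemma adj_spec u v : adj u v = true <-> in_H2 u /\ in_H2 v /\ dot u v = 0.
Proof.
  unfold adj. destruct (Req_EM_T _ _), (in_H2_dec u), (in_H2_dec v); intuition discriminate.
Qed.

Lemma adj_sym u v : adj u v = adj v u.
Proof.
  apply eq_true_iff_eq. rewrite !adj_spec, dot_comm. tauto.
Qed.

Lemma adj_irr u : adj u u = false.
Proof.
  destruct (adj u u) eqn:H; auto. apply adj_spec in H. destruct H as (H&_&H0).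
  apply in_H2_unit in H. lra.
Qed.

Lemma adj_C4 a b c d : adj a b = true -> adj b c = true -> adj c d = true -> adj d a = true -> a = c \/ b = d.
Proof.
  rewrite !adj_spec. intros (?&?&?) (?&?&?) (?&?&?) (?&?&?). apply orthogonal_C4; auto.
Qed.

Lemma adj_X v0 v1 v2 v3 v4 v5 v6 v7 v8 v9 :
  adj v0 v1 = true -> adj v0 v2 = true -> adj v0 v3 = true -> adj v2 v3 = true ->
  adj v1 v4 = true -> adj v1 v5 = true -> adj v4 v5 = true ->
  adj v2 v6 = true -> adj v2 v7 = true -> adj v6 v7 = true ->
  adj v4 v8 = true -> adj v4 v9 = true -> adj v8 v9 = true ->
  adj v3 v8 = true -> adj v5 v7 = true -> adj v6 v9 = true -> v3 = v1 \/ v5 = v0.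
Proof.
  rewrite !adj_spec. intros. apply (unembeddable v0 v1 v2 v3 v4 v5 v6 v7 v8 v9); tauto.
Qed.

Theorem mainTheorem13 (K : list vec3) :
  KS_system K -> (18 <= length K)%nat.
Proof.
  intros [[HK HH] Hn]. destruct (Nat.le_gt_cases 18 (length K)) as [H|H]; auto.
  exfalso. apply Hn.
  destruct (graph_colourable vec3 vec3_eq_dec adj adj_sym adj_irr adj_C4 adj_X 17 K) as [c [H1 H2]];
    auto; [apply Nat.lt_succ_r; auto|].
  exists c. split.
  - intros u v Hu Hv Ho [Cu Cv]. destruct (H1 u v Hu Hv) as [E|E]; try congruence.
    apply adj_spec. auto.
  - intros u v w Hu Hv Hw O1 O2 O3 (C1&C2&C3).
    destruct (H2 u v w Hu Hv Hw) as [E|[E|E]]; try congruence.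
    repeat split; apply adj_spec; auto.
Qed.
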